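(* Let $\alpha,\beta\in(1,2)$, $\varsigma_\alpha=|\cos(\frac{\alpha}{2}\pi)|$, $\varsigma_\beta=|\cos(\frac{\beta}{2}\pi)|$, and let $d,e$ be nonnegative functions on $\Omega=(x_L,x_R)\times(y_L,y_R)$. (i) Assume $0\le\kappa_{min}^d(y)\le d(x,y)\le\kappa_{max}^d(y)<\infty$ for every $(x,y)$ and $0\le\kappa_{min}^e(x)\le e(x,y)\le\kappa_{max}^e(x)<\infty$ for every $(x,y)$. Then $I\in\mathfrak{D}$ if the following conditions are fulfilled: $$\kappa^d(y)-\frac{\sqrt2\big(\kappa_{max}^d(y)-\kappa_{min}^d(y)\big)}{\varsigma_\alpha}\ge0\ \text{ for every } y,\qquad \kappa^e(x)-\frac{\sqrt2\big(\kappa_{max}^e(x)-\kappa_{min}^e(x)\big)}{\varsigma_\beta}\ge0\ \text{ for every } x,$$ where $\kappa^d(y)=\kappa^d_{max}(y)$ when $d(x,y)$ is a concave function of $x$, $\kappa^d(y)=\kappa^d_{min}(y)$ when $d(x,y)$ is a convex function of $x$, $\kappa^e(x)=\kappa^e_{max}(x)$ when $e(x,y)$ is a concave function of $y$, and $\kappa^e(x)=\kappa^e_{min}(x)$ when $e(x,y)$ is a convex function of $y$. (ii) Assume $0\le\kappa_{min}^{e'}(x)\le\frac{e(x,y)}{d(x,y)}\le\kappa_{max}^{e'}(x)<\infty$ for every $(x,y)$, with $0<d(x,y)<\infty$. Then $D^{-1}\in\mathfrak{D}$ if $$\kappa^{e'}(x)-\frac{\sqrt2\big(\kappa_{max}^{e'}(x)-\kappa_{min}^{e'}(x)\big)}{\varsigma_\beta}\ge0\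 \text{ for every } x,$$ where $\kappa^{e'}(x)=\kappa_{max}^{e'}(x)$ when $\frac{e(x,y)}{d(x,y)}$ is a concave function of $y$, and $\kappa^{e'}(x)=\kappa_{min}^{e'}(x)$ when $\frac{e(x,y)}{d(x,y)}$ is a convex function of $y$. (iii) Assume $0\le\kappa_{min}^{d'}(y)\le\frac{d(x,y)}{e(x,y)}\le\kappa_{max}^{d'}(y)<\infty$ for every $(x,y)$, with $0<e(x,y)<\infty$. Then $E^{-1}\in\mathfrak{D}$ if $$\kappa^{d'}(y)-\frac{\sqrt2\big(\kappa_{max}^{d'}(y)-\kappa_{min}^{d'}(y)\big)}{\varsigma_\alpha}\ge0\ \text{ for every } y,$$ where $\kappa^{d'}(y)=\kappa_{max}^{d'}(y)$ when $\frac{d(x,y)}{e(x,y)}$ is a concave function of $x$, and $\kappa^{d'}(y)=\kappa_{min}^{d'}(y)$ when $\frac{d(x,y)}{e(x,y)}$ is a convex function of $x$.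
   Context: In each part the function in question is understood to be, for each fixed value of the other variable, concave or convex in the indicated variable, so that $\kappa^d,\kappa^e,\kappa^{e'},\kappa^{d'}$ are defined. Let $T>0$, $M_1,M_2,N$ positive integers, $\tau=T/N$, $h_1=\frac{x_R-x_L}{M_1+1}$, $h_2=\frac{y_R-y_L}{M_2+1}$, $x_i=x_L+ih_1$, $y_j=y_L+jh_2$. $D$ and $E$ are the $M_1M_2\times M_1M_2$ diagonal matrices with diagonal entries $d(x_i,y_j)$ and $e(x_i,y_j)$, $1\le i\le M_1$, $1\le j\le M_2$, ordered with the index $i$ running fastest. For $\gamma\in(1,2)$ define $g_0^{(\gamma)}=1$, $g_k^{(\gamma)}=\left(1-\frac{\gamma+1}{k}\right)g_{k-1}^{(\gamma)}$ $(k\ge1)$, $w_0^{(\gamma)}=\frac{\gamma}{2}g_0^{(\gamma)}$, $w_k^{(\gamma)}=\frac{\gamma}{2}g_k^{(\gamma)}+\frac{2-\gamma}{2}g_{k-1}^{(\gamma)}$ $(k\ge1)$. $G_\gamma$ is the Toeplitz matrix with $(i,j)$ entry $w_{i-j+1}^{(\gamma)}$ if $i-j+1\ge0$ and $0$ otherwise; $G_\alpha$ has size $M_1\times M_1$, $G_\beta$ has size $M_2\times M_2$. $\otimes$ is the Kronecker product and $I$ an identity matrix of the appropriate size. Put $A=\frac{1}{2h_1^\alpha}D(I\otimes G_\alpha)+\frac{1}{2h_2^\beta}E(G_\beta\otimes I)$ and, for a square matrix $X$, let $\mathcal{H}(X)=(X+X^T)/2$ be its symmetric part. $\mathfrak{D}$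 is the set of matrices $X$ (understood as families depending on the discretization) such that $X$ is Hermitian (for real matrices, symmetric) positive definite, $-\mathcal{H}(XA)$ is positive semidefinite, and $\mathrm{cond}(X)=\|X\|_2\|X^{-1}\|_2\le c$ for a constant $c$ independent of $\tau$, $h_1$ and $h_2$.
   Formalization: In (ii) and (iii), ''0<d<∞'' (resp. ''0<e<∞'') is taken uniformly: 0<m≤d≤M (resp. e) on Ω for constants m, M; with pointwise positivity the claim fails, e.g. d=x, e=0 on the unit square gives cond(D^{-1})=M_1. *)

(* Defs.v *)
From HB Require Import structures.
From mathcomp Require Import all_boot all_order all_algebra.
From mathcomp Require Import all_classical all_reals all_analysis.
From mathcomp.real_closed Require Export mxtens.

Set Implicit Arguments.
Unset Strict Implicit.
Unset Printing Implicit Defensive.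

Import Order.TTheory GRing.Theory Num.Theory.

Local Open Scope classical_set_scope.
Local Open Scope ring_scope.

Section MatrixNotions.
Variable R : realType.

Definition norm2 (n : nat) (v : 'cV[R]_n) : R :=
  Num.sqrt (\sum_(i < n) v i 0 ^+ 2).

Definition opnorm2 (n : nat) (X : 'M[R]_n) : R :=
  sup [set norm2 (X *m v) | v in [set v : 'cV[R]_n | norm2 v <= 1]].

Definition cond2 (n : nat) (X : 'M[R]_n) : R := opnorm2 X * opnorm2 (invmx X).

Definition sympart (n : nat) (X : 'M[R]_n) : 'M[R]_n := 2^-1 *: (X + X^T).

Definition posdef (n : nat) (X : 'M[R]_n) : Prop :=
  X^T = X /\ forall v : 'cV[R]_n, v != 0 -> 0 < (v^T *m X *m v) 0 0.

Definition possemidef (n : nat) (X : 'M[R]_n) : Prop :=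
  X^T = X /\ forall v : 'cV[R]_n, 0 <= (v^T *m X *m v) 0 0.

End MatrixNotions.

Section Discretization.
Variable R : realType.

Fixpoint gcoef (gamma : R) (k : nat) : R :=
  if k is k'.+1 then (1 - (gamma + 1) / k%:R) * gcoef gamma k' else 1.

Definition wcoef (gamma : R) (k : nat) : R :=
  if k is k'.+1
  then gamma / 2 * gcoef gamma k + (2 - gamma) / 2 * gcoef gamma k'
  else gamma / 2 * gcoef gamma 0.

Definition Gmx (gamma : R) (n : nat) : 'M[R]_n :=
  \matrix_(i, j) if (j <= i.+1)%N then wcoef gamma (i.+1 - j) else 0.

Definition step (a b : R) (M : nat) : R := (b - a) / (M.+1)%:R.

Definition node (a b : R) (M k : nat) : R := a + k%:R * step a b M.

(* [mxtens_unindex k] is the pair (k %/ M1, k %% M1) of 0-based y- and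
   x-indices: the x-index runs fastest, and the same indexing underlies the
   Kronecker product [*t]. *)
Definition coefmx (xL xR yL yR : R) (f : R -> R -> R) (M1 M2 : nat) :
    'M[R]_(M2 * M1) :=
  diag_mx (\row_k f (node xL xR M1 (mxtens_unindex k).2.+1)
                    (node yL yR M2 (mxtens_unindex k).1.+1)).

Definition Amx (xL xR yL yR alpha beta : R) (d e : R -> R -> R)
    (M1 M2 : nat) : 'M[R]_(M2 * M1) :=
  (2 * step xL xR M1 `^ alpha)^-1 *:
    (coefmx xL xR yL yR d M1 M2 *m ((1%:M : 'M[R]_M2) *t Gmx alpha M1))
  + (2 * step yL yR M2 `^ beta)^-1 *:
    (coefmx xL xR yL yR e M1 M2 *m (Gmx beta M2 *t (1%:M : 'M[R]_M1))).

(* A family of matrices is indexed by the time step tau and by M1, M2, which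
   determine the mesh sizes; tau ranges over the values T / N. *)
Definition mxfamily := R -> forall M1 M2 : nat, 'M[R]_(M2 * M1).

Definition frakD (xL xR yL yR T alpha beta : R) (d e : R -> R -> R)
    (X : mxfamily) : Prop :=
  exists c : R, forall N M1 M2 : nat, (0 < N)%N -> (0 < M1)%N -> (0 < M2)%N ->
    let Y := X (T / N%:R) M1 M2 in
    [/\ posdef Y,
        possemidef (- sympart (Y *m Amx xL xR yL yR alpha beta d e M1 M2))
      & cond2 Y <= c].

End Discretization.

Section Curvature.
Variable R : realType.

Definition convex_on (a b : R) (f : R -> R) : Prop :=
  convex_function [set` `]a, b[] (f : R^o -> R^o).

Definition concave_on (a b : R) (f : R -> R) : Prop :=
  convex_on a b (fun x => - f x).

(* A disjunction rather than two implications: an affine f is both concave and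
   convex, and then either choice of k is admitted. *)
Definition is_kappa (a b : R) (f : R -> R) (kmin kmax k : R) : Prop :=
  (concave_on a b f /\ k = kmax) \/ (convex_on a b f /\ k = kmin).

(* For a real-valued f, "0 < f < oo on the rectangle" is read uniformly, as the
   existence of bounds 0 < m <= f <= M. Pointwise positivity does not bound the
   condition number of the diagonal matrix of the values of f: take
   f(x, y) = x on the unit square. *)
Definition pos_bounded (xL xR yL yR : R) (f : R -> R -> R) : Prop :=
  exists m M : R, 0 < m /\
    forall x y, x \in `]xL, xR[ -> y \in `]yL, yR[ -> m <= f x y <= M.

End Curvature.

(* Main.v *)
Require Import Defs.
From mathcomp Require Import all_boot all_order all_algebra.
From mathcomp Require Import all_classical all_reals all_analysis.
From mathcomp Require Import ring lra zify.

Import Order.TTheory GRing.Theory Num.Theory.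
Local Open Scope ring_scope.
Set Implicit Arguments.
Unset Strict Implicit.
Unset Printing Implicit Defensive.

(** The Kronecker structure splits the quadratic form of [Y *m Amx], for [Y] the
    diagonal matrix of the values of [1], [1 / d] or [1 / e], into a sum over
    grid lines of one-dimensional forms v^T P G v, with P the diagonal matrix of
    the samples along that line of one of the functions d, e, e / d, d / e, 1.
    So everything reduces to showing that such a form is nonpositive. Write
    Q(v) = - v^T G v and s = |cos (gamma pi / 2)|.

    Sector bound ([Gform_sector]): Q >= 0 and 2 s |u^T G v| <= Q(u) + Q(v). On the
    unit circle z = e^(it), the symbol of G is
    z^-1 (gamma / 2 + (1 - gamma / 2) z) (1 - z)^gamma. The phase of
    (1 - z)^gamma is gamma (t - pi) / 2 on (0, 2 pi), and with it the symbol
    turns out to lie in the sector s |f| <= - Re f ([symbol_sector], which comes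
    down to the convexity of tan). The form inequality is the average over t of
    the pointwise inequality 2 s |x| |f| |y| <= - Re f (|x|^2 + |y|^2), where x
    and y are the Fourier transforms of u and v. All sums are truncated at an
    order n and averaged over a finite grid of angles, which is exact for
    trigonometric polynomials; the truncation error is a multiple of n g_n and
    vanishes as n grows. The phase itself is found without summing the binomial
    series on its circle of convergence: the truncated sums satisfy the
    differential equation of (1 - z)^gamma up to a residual of size n g_n
    ([symbol_ode_residual], [rotated_symbol_bound]).

    Convex multipliers ([Gform_contraction]): if p has convex samples in [0, 1],
    then Q(p v) <= 2 Q(v). The symmetric part of G has nonnegative off-diagonal
    entries, so the matrix with entries (2 - p_i p_j) G_ij is negative
    semidefinite once the row sums of its symmetric part are nonpositive. Pairing
    the neighbours i - k and i + k, these row sums reduce to the midpoint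
    convexity of p, and at the boundary of the grid, where one neighbour is
    missing, the constant 2 is just large enough.

    Conclusion ([Gform_coef_le0]): write P = kappa + c Delta p with c = 1 and
    kappa = kappa_min in the convex case, c = -1 and kappa = kappa_max in the
    concave case, and Delta = kappa_max - kappa_min. Then p is convex with values
    in [0, 1], and the two bounds, with u = p v scaled by 1 / sqrt 2, give
    - v^T P G v >= (kappa - sqrt 2 Delta / s) Q(v) >= 0. *)

(** * The coefficients of the difference formula *)

Lemma gcoefS (R : realType) (a : R) k :
  k.+1%:R * gcoef a k.+1 = (k%:R - a) * gcoef a k.
Proof.
rewrite /= mulrA; congr (_ * _).
by rewrite mulrBr mulr1 mulrC divfK ?pnatr_eq0// -natr1; ring.
Qed.

(** Both sides are multiples of the product of the factors 1 - a / k over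
    0 < k < n: partial sums of the binomial series of (1 - z)^a at z = 1 are again
    binomial coefficients. This makes n g_n the natural measure of the truncation
    errors below. *)
Lemma gcoef_sum (R : realType) (a : R) n :
  a * (\sum_(k < n) gcoef a k) = - (n%:R * gcoef a n).
Proof.
elim: n => [|n IH]; first by rewrite big_ord0 mulr0 mul0r oppr0.
by rewrite big_ord_recr /= mulrDr IH gcoefS; ring.
Qed.

Lemma gcoef1 (R : realType) (a : R) : gcoef a 1 = - a.
Proof. by rewrite /= divr1 mulr1; ring. Qed.

Lemma gcoef2 (R : realType) (a : R) : gcoef a 2 = a * (a - 1) / 2.
Proof. by rewrite /= divr1 mulr1; field. Qed.

Lemma gcoef_gt0 (R : realType) (a : R) (a1 : 1 < a) (a2 : a < 2) k :
  0 < gcoef a k.+2.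
Proof.
elim: k => [|k IH].
  by rewrite gcoef2; nra.
have h := gcoefS a k.+2.
have h1 : 0 < (k.+2%:R - a) * gcoef a k.+2.
  by rewrite mulr_gt0// subr_gt0 -addn2 natrD; have := ler0n R k; lra.
by move: h1; rewrite -h pmulr_rgt0.
Qed.

Lemma gcoef_sum_le0 (R : realType) (a : R) (a1 : 1 < a) (a2 : a < 2) n :
  \sum_(k < n.+2) gcoef a k <= 0.
Proof.
have a0 : 0 < a by lra.
rewrite -(pmulr_rle0 _ a0) gcoef_sum oppr_le0.
by rewrite mulr_ge0// ltW// gcoef_gt0.
Qed.

(** The recursion multiplies n g_n by (n - a) / n <= (n - 1) / n, hence
    (n - 1) n g_n decreases in n. *)
Lemma gcoef_decay (R : realType) (a : R) (a1 : 1 < a) (a2 : a < 2) k :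
  k.+1%:R * (k.+2%:R * gcoef a k.+2) <= 2.
Proof.
elim: k => [|k IH].
  by rewrite gcoef2; nra.
apply: le_trans IH.
rewrite gcoefS mulrCA; apply: ler_wpM2r.
  by apply: mulr_ge0 => //; exact/ltW/gcoef_gt0.
by rewrite -(natr1 k.+1); lra.
Qed.

Lemma gcoef_tail (R : realType) (a : R) (a1 : 1 < a) (a2 : a < 2) m n :
  (1 < m)%N -> (m <= n)%N ->
  \sum_(m <= k < n) gcoef a k <= m%:R * gcoef a m.
Proof.
case: m => [|[|m]]// _; case: n => [|[|n]]// mn.
have a0 : 0 < a by lra.
have := gcoef_sum_le0 a1 a2 n.
rewrite -(big_mkord xpredT) (big_cat_nat (n := m.+2))//=.
rewrite big_mkord => h.
have h2 : 0 <= m.+2%:R * gcoef a m.+2 by rewrite mulr_ge0 ?ltW ?(gcoef_gt0 a1 a2).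
have := gcoef_sum a m.+2; move: h h2.
set S := \sum_(i < _) _; set T := \sum_(_ <= i < _) _; set b := _ * _.
move=> h1 h2 h3.
have : a * T <= b by nra.
by nra.
Qed.

Lemma wcoef_ge0 (R : realType) (a : R) (a1 : 1 < a) (a2 : a < 2) k :
  0 <= wcoef a k.+3.
Proof.
have := gcoef_gt0 a1 a2 k; have := gcoef_gt0 a1 a2 k.+1.
rewrite [wcoef _ _]/= -/(gcoef a k.+3) -/(gcoef a k.+2).
move=> h1 h2; rewrite addr_ge0// mulr_ge0 ?ltW//; lra.
Qed.

(** The weights of indices 0 and 2 meet in the first off-diagonal of the
    symmetric part of G; the weight of index 2 alone may be negative. *)
Lemma wcoef02_ge0 (R : realType) (a : R) (a1 : 1 < a) (a2 : a < 2) :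
  0 <= wcoef a 0 + wcoef a 2.
Proof. by rewrite /wcoef gcoef2 gcoef1 /=; nra. Qed.

Lemma wcoef_sum_le0 (R : realType) (a : R) (a1 : 1 < a) (a2 : a < 2) n :
  \sum_(k < n.+3) wcoef a k <= 0.
Proof.
have -> : \sum_(k < n.+3) wcoef a k =
  a / 2 * (\sum_(k < n.+3) gcoef a k) + (2 - a) / 2 * (\sum_(k < n.+2) gcoef a k).
  rewrite [LHS]big_ord_recl [X in a / 2 * X]big_ord_recl mulrDr -addrA.
  by congr (_ + _); rewrite !mulr_sumr -big_split.
have := gcoef_sum_le0 a1 a2 n; have := gcoef_sum_le0 a1 a2 n.+1; nra.
Qed.

Local Arguments gcoef : simpl never.
Local Arguments wcoef : simpl never.

(** * The symbol on the unit circle *)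

(** For F = (1 - z)^a and z = e^(it) one has dF/dt = - i a z F / (1 - z); after the
    rotation by the phase a (t - pi) / 2 this becomes the real equation
    sin (t / 2) Y' = (a / 2) cos (t / 2) Y. The recursion of the coefficients makes
    the truncated sums satisfy it up to the single term of index n. *)
Lemma symbol_ode_residual (R : realType) (a : R) n (t psi : R) :
  - sin (t / 2) * \sum_(k < n) (k%:R - a / 2) * (gcoef a k * sin (k%:R * t - psi))
  = a / 2 * cos (t / 2) * \sum_(k < n) gcoef a k * cos (k%:R * t - psi)
    + n%:R * gcoef a n / 2 * cos ((n%:R - 2^-1) * t - psi).
Proof.
elim: n => [|n IH]; first by rewrite !big_ord0 !mulr0 !mul0r addr0.
rewrite !big_ord_recr/= mulrDr IH gcoefS.
have -> : (n%:R - 2^-1) * t - psi = (n%:R * t - psi) - t / 2 by field.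
have -> : (n.+1%:R - 2^-1) * t - psi = (n%:R * t - psi) + t / 2.
  by rewrite -natr1; field.
set X := n%:R * t - psi.
by rewrite cosB (cosD X); field.
Qed.

(** The component in direction [delta] of the truncated binomial series of
    (1 - e^(it))^a, after rotation by its expected phase a (t - pi) / 2: real part
    for [delta] = 0, imaginary part for [delta] = pi / 2. *)
Definition rotated_symbol (R : realType) (a : R) (n : nat) (delta t : R) : R :=
  \sum_(k < n) gcoef a k * cos (k%:R * t - (a / 2 * (t - pi) + delta)).

Lemma is_derive_rotated_symbol (R : realType) (a : R) n (delta t : R) :
  is_derive t 1 (rotated_symbol a n delta)
   (- \sum_(k < n) (k%:R - a / 2) *
       (gcoef a k * sin (k%:R * t - (a / 2 * (t - pi) + delta)))).
Proof.
rewrite /rotated_symbol.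
have -> : (fun t : R => \sum_(k < n) gcoef a k *
     cos (k%:R * t - (a / 2 * (t - pi) + delta))) =
  \sum_(k < n) (fun t => gcoef a k * cos (k%:R * t - (a / 2 * (t - pi) + delta))).
  by apply/funext => u; rewrite fct_sumE.
rewrite -sumrN.
apply: is_derive_sum => k.
pose h := (fun t : R => k%:R * t - (a / 2 * (t - pi) + delta)).
have hh : is_derive t 1 h (k%:R - a / 2).
  by rewrite /h; apply: is_derive_eq; rewrite /GRing.scale/=; ring.
have H := @is_derive1_comp _ cos h t _ _ (is_derive_cos _) hh.
have H2 := is_deriveZ (gcoef a k) H.
by apply: is_derive_eq; rewrite /GRing.scale /h/=; ring.
Qed.

Lemma sin_half_le (R : realType) (u v : R) :
  0 <= u -> u <= v -> v <= pi -> sin (u / 2) <= sin (v / 2).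
Proof.
move=> u0 uv vpi; have p0 := pi_gt0 R.
have [->//|nuv] := eqVneq u v.
have {nuv}uv' : u < v by rewrite lt_neqAle nuv.
apply/ltW; rewrite ltr_sin ?in_itv/=; first by lra.
  by apply/andP; split; lra.
by apply/andP; split; lra.
Qed.

(** The integrating factor sin (t / 2)^(-a) turns the differential equation into
    a bound on the derivative of the product, and the mean value theorem compares
    the values at [theta] and at pi, where the factor is 1. *)
Lemma rotated_symbol_bound (R : realType) (a theta : R) (a1 : 1 < a) (a2 : a < 2) :
  0 < theta <= pi ->
  exists c K : R, 0 < c /\ forall n delta, (1 < n)%N ->
    `|rotated_symbol a n delta theta - c * rotated_symbol a n delta pi|
      <= K * (n%:R * gcoef a n).
Proof.
move=> /andP[t0 tpi].
have a0 : 0 < a by exact: lt_trans a1.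
have b0 n : (1 < n)%N -> 0 <= n%:R * gcoef a n.
  by case: n => [|[|n]]// _; rewrite mulr_ge0// ltW// gcoef_gt0.
clear a1 a2.
have sgt0 (t : R) : theta <= t <= pi -> 0 < sin (t / 2).
  by move=> /andP[h1 h2]; apply: sin_gt0_pi; have := pi_gt0 R; lra.
have sle (t : R) : theta <= t <= pi -> sin (theta / 2) <= sin (t / 2).
  by move=> /andP[h1 h2]; apply: sin_half_le => //; exact: ltW.
pose E (t : R) := expR (- a * ln (sin (t / 2))).
pose DE (t : R) := E t * (- a * (cos (t / 2) / 2 / sin (t / 2))).
have dE (t : R) : theta <= t <= pi -> is_derive t 1 E (DE t).
  move=> ht; have st := sgt0 t ht.
  have h1 : is_derive t 1 (fun t : R => t / 2) 2^-1.
    by apply: is_derive_eq; rewrite /GRing.scale/=; ring.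
  have h2 := @is_derive1_comp _ (@sin R) (fun t : R => t / 2) t _ _
    (is_derive_sin _) h1.
  have h3 := @is_derive1_comp _ (@ln R) (sin \o (fun t : R => t / 2)) t _ _
    (is_derive1_ln st) h2.
  have h4 := is_deriveZ (- a) h3.
  have h5 := @is_derive1_comp _ (@expR R) _ t _ _ (is_derive_expR _) h4.
  apply: is_derive_eq h5 _.
  rewrite /DE /E /GRing.scale/=.
  by congr (_ * (- a * _)); rewrite mulrC.
have Epi : E pi = 1 by rewrite /E sin_pihalf ln1 mulr0 expR0.
have thin : theta <= theta <= pi by rewrite lexx.
have sth := sgt0 _ thin.
exists (E theta)^-1, (pi / 2 / sin (theta / 2)); split; first by rewrite invr_gt0 expR_gt0.
move=> n delta n1.
pose b := n%:R * gcoef a n.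
pose Y := rotated_symbol a n delta.
pose res t := cos ((n%:R - 2^-1) * t - (a / 2 * (t - pi) + delta)).
have [t tin MVTt] : exists2 t, t \in `[theta, pi] &
    E pi * Y pi - E theta * Y theta
      = E t * (b / 2 * res t / sin (t / 2)) * (pi - theta).
  have dH (t : R) : theta <= t <= pi ->
      is_derive t 1 (E * Y) (E t * (b / 2 * res t / sin (t / 2))).
    move=> ht; have st := sgt0 t ht.
    have d1 := dE t ht; have d2 := is_derive_rotated_symbol a n delta t.
    have d3 := is_deriveM d1 d2.
    apply: is_derive_eq d3 _.
    have ode := symbol_ode_residual a n t (a / 2 * (t - pi) + delta).
    move: ode; rewrite -/(res t) -/b /GRing.scale/= -/(Y t).
    set X := \sum_(k < n) _ => ode.
    have -> : - X = (a / 2 * cos (t / 2) * Y t + b / 2 * res t) / sin (t / 2).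
      by rewrite -[X in X / _]ode mulrAC mulNr divff ?gt_eqF// mulN1r.
    by rewrite /DE; field; rewrite gt_eqF.
  apply: (@MVT_segment R (E * Y)
    (fun t => E t * (b / 2 * res t / sin (t / 2))) theta pi tpi).
    by move=> x; rewrite in_itv/= => /andP[h1 h2]; apply: dH; rewrite !ltW.
  apply: derivable_within_continuous => x; rewrite in_itv/= => hx.
  by have [] := dH x hx.
move: tin; rewrite in_itv/= => tin.
have st := sgt0 t tin.
have EtE : E t / E theta <= 1.
  rewrite ler_pdivrMr ?expR_gt0// mul1r /E ler_expR.
  by rewrite !mulNr lerN2 ler_pM2l// ler_ln ?posrE// sle.
have Et0 : 0 <= E t / E theta by rewrite divr_ge0// expR_ge0.
rewrite -/(Y theta) -/(Y pi).
have -> : Y theta - (E theta)^-1 * Y pi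
     = - (E t / E theta * (b / 2 * res t / sin (t / 2)) * (pi - theta)).
  have E0 : E theta != 0 by rewrite gt_eqF// expR_gt0.
  apply: (mulfI E0); move: MVTt; rewrite Epi mul1r => MVTt.
  transitivity (- (Y pi - E theta * Y theta)); first by field.
  by rewrite MVTt; field; rewrite E0 gt_eqF.
rewrite normrN -/b normrM normrM.
rewrite (ger0_norm Et0) (@ger0_norm _ (pi - theta)) ?subr_ge0//.
have rb : `|b / 2 * res t / sin (t / 2)| <= b / 2 / sin (theta / 2).
  have b20 : 0 <= b / 2 by rewrite divr_ge0 ?b0.
  rewrite normrM (normrM (b / 2)) normfV (gtr0_norm st) (ger0_norm b20).
  apply: ler_pM; [exact: mulr_ge0|by rewrite invr_ge0 ltW| |].
    by apply: ler_piMr => //; exact: cos_max.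
  by rewrite lef_pV2 ?posrE// sle.
have -> : pi / 2 / sin (theta / 2) * b = 1 * (b / 2 / sin (theta / 2)) * pi.
  by field; rewrite gt_eqF.
apply: ler_pM; [exact: mulr_ge0|by rewrite subr_ge0| |].
  by apply: ler_pM.
by rewrite lerBlDr lerDl ltW.
Qed.

(** That is, tan (eps x) <= eps tan x, the convexity of tan on [0, pi / 2[, freed of
    denominators so that it holds at pi / 2 too. *)
Lemma tan_contraction (R : realType) (eps x : R) :
  0 < eps <= 1 -> 0 <= x <= pi / 2 ->
  cos x * sin (eps * x) <= eps * sin x * cos (eps * x).
Proof.
move=> /andP[e0 e1] /andP[x0 xpi].
pose f (t : R) := eps * sin t * cos (eps * t) - cos t * sin (eps * t).
pose df (t : R) := (1 - eps ^+ 2) * (sin t * sin (eps * t)).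
have dfE (t : R) : is_derive t 1 f (df t).
  have dl : is_derive t 1 (fun t : R => eps * t) eps.
    by apply: is_derive_eq; rewrite /GRing.scale/=; ring.
  have ds := @is_derive1_comp _ (@sin R) (fun t : R => eps * t) t _ _
    (is_derive_sin _) dl.
  have dc := @is_derive1_comp _ (@cos R) (fun t : R => eps * t) t _ _
    (is_derive_cos _) dl.
  have d1 := is_deriveM (is_deriveZ eps (is_derive_sin t)) dc.
  have d2 := is_deriveM (is_derive_cos t) ds.
  apply: is_derive_eq (is_deriveB d1 d2) _.
  by rewrite /df /GRing.scale/= /GRing.scale/=; ring.
have [|c] := @MVT_segment R f df 0 x x0 (fun t _ => dfE t).
  by apply: derivable_within_continuous => t _; have [] := dfE t.
rewrite in_itv/= => /andP[c0 cx].
have -> : f 0 = 0 by rewrite /f !(mulr0, sin0, mul0r) subrr.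
rewrite !subr0 => fx.
rewrite -subr_ge0 -/(f x) fx mulr_ge0// mulr_ge0//.
  by rewrite subr_ge0 expr_le1// ltW.
have pi0 := pi_gt0 R.
rewrite mulr_ge0// sin_ge0_pi//; apply/andP; split; [by lra|by lra| |].
  by rewrite mulr_ge0// ltW.
by apply: (@le_trans _ _ c); [rewrite ler_piMl|lra].
Qed.

(** The numbers [- A] and [- B] are the real and imaginary parts of
    (a / 2 e^(-i theta) + (1 - a / 2)) e^(i omega), the direction of the symbol at
    [theta]. With eps = a - 1 and phi = (pi - theta) / 2, the vector (A, B) is the
    vector (eps cos phi, sin phi) rotated by the angle - eps phi, so that the
    bound says that the argument of (eps cos phi, sin phi) exceeds eps phi by at
    most (1 - eps) pi / 2. This is [tan_contraction] at the complementary angle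
    theta / 2. *)
Lemma symbol_sector (R : realType) (a theta : R) (a1 : 1 < a) (a2 : a < 2) :
  0 <= theta <= pi ->
  let omega := a / 2 * (theta - pi) in
  let A := - (a / 2 * cos (omega - theta) + (2 - a) / 2 * cos omega) in
  let B := - (a / 2 * sin (omega - theta) + (2 - a) / 2 * sin omega) in
  [/\ 0 <= A, 0 <= B &
    sin ((a - 1) * (pi / 2)) * B <= cos ((a - 1) * (pi / 2)) * A].
Proof.
move=> /andP[t0 tpi] /=.
pose chi := theta / 2; pose phi := pi / 2 - chi; pose eps := a - 1.
have pi0 := pi_gt0 R.
have chi_in : 0 <= chi <= pi / 2 by rewrite /chi; apply/andP; split; lra.
have phi_in : 0 <= phi <= pi / 2.
  by move: chi_in => /andP[? ?]; rewrite /phi; apply/andP; split; lra.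
have e01 : 0 < eps <= 1.
  by rewrite /eps; clear pi0 tpi chi_in phi_in; apply/andP; split; lra.
have -> : a / 2 * (theta - pi) - theta = - ((phi + eps * phi) - (phi *+ 2) + pi).
  by rewrite /phi /chi /eps; field.
have -> : a / 2 * (theta - pi) = - (phi + eps * phi).
  by rewrite /phi /chi /eps; field.
rewrite !cosN !sinN sinDpi cosDpi.
have -> : phi + eps * phi - phi *+ 2 = eps * phi - phi by rewrite mulr2n; ring.
rewrite (cosD phi) (sinD phi) (cosB (eps * phi)) (sinB (eps * phi)) -/eps.
have H1 := tan_contraction e01 phi_in.
have H2 := tan_contraction e01 chi_in.
have echi : eps * chi = eps * (pi / 2) - eps * phi by rewrite /phi; ring.
have cchi : cos chi = sin phi.
  have -> : chi = pi / 2 - phi by rewrite /phi; ring.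
  by rewrite cosB cos_pihalf sin_pihalf; ring.
have schi : sin chi = cos phi.
  have -> : chi = pi / 2 - phi by rewrite /phi; ring.
  by rewrite sinB cos_pihalf sin_pihalf; ring.
rewrite echi sinB cosB cchi schi in H2.
have first_quadrant (x : R) : 0 <= x <= pi / 2 -> 0 <= sin x /\ 0 <= cos x.
  move=> /andP[? ?]; split; last by apply: cos_ge0_pihalf; apply/andP; split; lra.
  by apply: sin_ge0_pi; apply/andP; split; lra.
have [s0 c0] := first_quadrant _ phi_in.
have ephi : 0 <= eps * phi <= pi / 2.
  move: e01 phi_in => /andP[e0 e1] /andP[p0 p1]; rewrite mulr_ge0 ?(ltW e0)//=.
  by apply: (le_trans _ p1); rewrite ler_piMl.
have [s'0 c'0] := first_quadrant _ ephi.
have ea : a = eps + 1 by rewrite /eps; ring.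
rewrite {}ea; move: e01 H1 H2 s0 c0 s'0 c'0; clearbody eps.
move: (sin (eps * (pi / 2))) (cos (eps * (pi / 2))).
move: (sin (eps * phi)) (cos (eps * phi)) (sin phi) (cos phi).
clear => s' c' s c Sg Kp /andP[e0 e1] H1 H2 s0 c0 s'0 c'0.
have sc' := mulr_ge0 s0 c'0; have ss' := mulr_ge0 s0 s'0; have cc' := mulr_ge0 c0 c'0.
split.
- have := mulr_ge0 (ltW e0) cc'. nra.
- have := mulr_ge0 (ltW e0) sc'; nra.
- nra.
Qed.

Lemma rotated_symbolE (R : realType) (a : R) n (delta t : R) :
  let psi := a / 2 * (t - pi) + delta in
  rotated_symbol a n delta t =
    cos psi * (\sum_(k < n) gcoef a k * cos (k%:R * t)) +
    sin psi * (\sum_(k < n) gcoef a k * sin (k%:R * t)).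
Proof.
rewrite /rotated_symbol /= !mulr_sumr -big_split/=; apply: eq_bigr => k _.
by rewrite cosB; ring.
Qed.

Lemma gcoef_tail_trig (R : realType) (a : R) (a1 : 1 < a) (a2 : a < 2)
    m n (f : nat -> R) :
  (1 < m)%N -> (m <= n)%N -> (forall k, `|f k| <= 1) ->
  `|\sum_(k < m) gcoef a k * f k - \sum_(k < n) gcoef a k * f k|
     <= m%:R * gcoef a m.
Proof.
move=> m1 mn f1; apply: le_trans (gcoef_tail a1 a2 m1 mn).
rewrite distrC -!(big_mkord xpredT (fun k => gcoef a k * f k)).
rewrite (big_cat_nat (leq0n m) mn)//= addrAC subrr add0r.
apply: le_trans (ler_norm_sum _ _ _) _.
apply: ler_sum_nat => k /andP[mk _].
have g0 : 0 <= gcoef a k.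
  by case: k mk => [|[|k]] mk; [lia|lia|exact/ltW/gcoef_gt0].
by rewrite normrM (ger0_norm g0); apply: ler_piMr.
Qed.

(** At z = -1 the binomial series is real, and its first two terms 1 + a outweigh
    the tail, whose terms sum to at most 2 g_2 = a (a - 1). *)
Lemma symbol_at_pi (R : realType) (a : R) (a1 : 1 < a) (a2 : a < 2) n :
  (1 < n)%N ->
  0 <= \sum_(k < n) gcoef a k * cos (k%:R * pi) /\
  \sum_(k < n) gcoef a k * sin (k%:R * pi) = 0.
Proof.
move=> n1; split; last first.
  apply: big1 => k _; rewrite -[k%:R * pi]add0r mulr_natl (alternatingn (@sinDpi R)).
  by rewrite sin0 !mulr0.
have := @gcoef_tail_trig R a a1 a2 2 n (fun k => cos (k%:R * pi)) isT n1
  (fun k => cos_max _).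
have -> : \sum_(k < 2) gcoef a k * cos (k%:R * pi) = 1 + a.
  rewrite -(big_mkord xpredT (fun k => gcoef a k * cos (k%:R * pi))).
  rewrite !big_nat_recr//= big_geq//.
  rewrite add0r gcoef1 mul0r cos0 !mul1r cospi.
  by rewrite mulrN1 opprK.
rewrite gcoef2.
rewrite ler_distlC => /andP[+ _]; clear n1.
move: (\sum_(k < n) _) => S; nra.
Qed.

(** [rotated_symbol_bound] for both components, at an order N >= n so large that
    its [theta]-dependent error is negligible; the tail between n and N then gives
    an error independent of [theta], as averaging over a grid that grows with n
    requires. *)
Lemma symbol_direction (R : realType) (a theta : R) (a1 : 1 < a) (a2 : a < 2) n :
  0 < theta <= pi -> (1 < n)%N ->
  let omega := a / 2 * (theta - pi) in
  exists m : R, [/\ 0 <= m,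
    `|\sum_(k < n) gcoef a k * cos (k%:R * theta) - m * cos omega|
       <= 2 * (n%:R * gcoef a n) &
    `|\sum_(k < n) gcoef a k * sin (k%:R * theta) - m * sin omega|
       <= 2 * (n%:R * gcoef a n)].
Proof.
move=> tin n1 omega.
pose b k := k%:R * gcoef a k.
have bgt0 k : (1 < k)%N -> 0 < b k.
  by case: k => [|[|k]]// _; rewrite mulr_gt0// gcoef_gt0.
have [c [K [c0 HK]]] := rotated_symbol_bound a1 a2 tin.
have [N nN KN] : exists2 N, (n <= N)%N & `|K| * b N <= b n / 2.
  pose M := Num.bound (4 * `|K| / b n).
  exists (n + M).+2; first by lia.
  have dec := gcoef_decay a1 a2 (n + M).
  have MK : 4 * `|K| / b n < (n + M).+1%:R.
    apply: lt_le_trans (archi_boundP _) _; first by rewrite !mulr_ge0// invr_ge0 ltW// bgt0.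
    by rewrite ler_nat; lia.
  rewrite ltr_pdivrMr ?bgt0// in MK.
  have M0 : 0 < (n + M).+1%:R :> R by [].
  rewrite -(ler_pM2l M0) mulrCA.
  have := ler_wpM2l (normr_ge0 K) dec; rewrite -/(b _); lra.
have N1 : (1 < N)%N by lia.
pose C k := \sum_(j < k) gcoef a j * cos (j%:R * theta).
pose S k := \sum_(j < k) gcoef a j * sin (j%:R * theta).
pose U := cos omega * C N + sin omega * S N.
pose V := cos omega * S N - sin omega * C N.
have bK : K * b N <= b n / 2.
  by apply: le_trans KN; apply: ler_wpM2r; [exact/ltW/bgt0|exact: ler_norm].
have [Cpi Spi] := symbol_at_pi a1 a2 N1.
have U0 : - (b n / 2) <= U.
  have := HK N 0 N1; rewrite !rotated_symbolE /= !addr0 subrr mulr0 cos0 sin0.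
  rewrite mul1r mul0r addr0.
  rewrite -/(C N) -/(S N) -/omega -/U ler_distl => /andP[+ _].
  have := mulr_ge0 (ltW c0) Cpi; rewrite -/(b N); lra.
have V0 : `|V| <= b n / 2.
  have := HK N (pi / 2) N1; rewrite !rotated_symbolE /= subrr mulr0 add0r.
  rewrite cos_pihalf mul0r Spi mulr0 addr0 mulr0 subr0.
  rewrite cosDpihalf sinDpihalf -/(C N) -/(S N) -/omega -/(b N) mulNr addrC -/V => h.
  exact: le_trans h bK.
have CE : C N = U * cos omega - V * sin omega.
  rewrite /U /V; transitivity (C N * (cos omega ^+ 2 + sin omega ^+ 2)); last by ring.
  by rewrite cos2Dsin2 mulr1.
have SE : S N = U * sin omega + V * cos omega.
  rewrite /U /V; transitivity (S N * (cos omega ^+ 2 + sin omega ^+ 2)); last by ring.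
  by rewrite cos2Dsin2 mulr1.
have tC := @gcoef_tail_trig R a a1 a2 n N (fun k => cos (k%:R * theta)) n1 nN
  (fun k => cos_max _).
have tS := @gcoef_tail_trig R a a1 a2 n N (fun k => sin (k%:R * theta)) n1 nN
  (fun k => sin_max _).
have Um : `|U - Num.max U 0| <= b n / 2.
  rewrite /Num.max; case: ifPn => [Ult|_].
    by rewrite subr0 ltr0_norm//; lra.
  by rewrite subrr normr0 divr_ge0// ltW// bgt0.
have small x y : `|x| <= b n / 2 -> `|y| <= 1 -> `|x * y| <= b n / 2.
  by move=> hx hy; rewrite normrM; apply: le_trans hx; apply: ler_piMr.
exists (Num.max U 0); split; first by rewrite le_max lexx orbT.
- have -> : \sum_(k < n) gcoef a k * cos (k%:R * theta) - Num.max U 0 * cos omega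
     = (C n - C N) + ((U - Num.max U 0) * cos omega + - V * sin omega).
    by rewrite CE /C; ring.
  apply: le_trans (ler_normD _ _) _; rewrite -/(b n) mulr_natl mulr2n.
  apply: lerD; first exact: tC.
  apply: le_trans (ler_normD _ _) _; rewrite [leRHS](splitr (b n)).
  by apply: lerD; apply: small; rewrite ?normrN ?cos_max ?sin_max.
- have -> : \sum_(k < n) gcoef a k * sin (k%:R * theta) - Num.max U 0 * sin omega
     = (S n - S N) + ((U - Num.max U 0) * sin omega + V * cos omega).
    by rewrite SE /S; ring.
  apply: le_trans (ler_normD _ _) _; rewrite -/(b n) mulr_natl mulr2n.
  apply: lerD; first exact: tS.
  apply: le_trans (ler_normD _ _) _; rewrite [leRHS](splitr (b n)).
  by apply: lerD; apply: small; rewrite ?cos_max ?sin_max.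
Qed.

Definition symbol_cos (R : realType) (a : R) n (t : R) : R :=
  \sum_(k < n) gcoef a k * cos (k%:R * t).
Definition symbol_sin (R : realType) (a : R) n (t : R) : R :=
  \sum_(k < n) gcoef a k * sin (k%:R * t).
(** The real and imaginary parts of (a / 2 e^(-it) + (1 - a / 2)) F, with F the
    truncated binomial series: the truncated symbol of [Gmx]. *)
Definition symbol_re (R : realType) (a : R) n (t : R) : R :=
  a / 2 * (symbol_cos a n t * cos t + symbol_sin a n t * sin t)
  + (2 - a) / 2 * symbol_cos a n t.
Definition symbol_im (R : realType) (a : R) n (t : R) : R :=
  a / 2 * (symbol_sin a n t * cos t - symbol_cos a n t * sin t)
  + (2 - a) / 2 * symbol_sin a n t.

Lemma cos_reflect (R : realType) k (t : R) :
  cos (k%:R * (pi *+ 2 - t)) = cos (k%:R * t).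
Proof.
rewrite mulrBr addrC [k%:R * (pi *+ 2)]mulr_natl (periodicn (@cosD2pi R)).
by rewrite cosN.
Qed.

Lemma sin_reflect (R : realType) k (t : R) :
  sin (k%:R * (pi *+ 2 - t)) = - sin (k%:R * t).
Proof.
rewrite mulrBr addrC [k%:R * (pi *+ 2)]mulr_natl (periodicn (@sinD2pi R)).
by rewrite sinN.
Qed.

Lemma symbol_reflect (R : realType) (a : R) n (t : R) :
  symbol_re a n (pi *+ 2 - t) = symbol_re a n t /\
  symbol_im a n (pi *+ 2 - t) = - symbol_im a n t.
Proof.
have hC : symbol_cos a n (pi *+ 2 - t) = symbol_cos a n t.
  by apply: eq_bigr => k _; rewrite cos_reflect.
have hS : symbol_sin a n (pi *+ 2 - t) = - symbol_sin a n t.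
  by rewrite -sumrN; apply: eq_bigr => k _; rewrite sin_reflect mulrN.
have := cos_reflect 1 t; have := sin_reflect 1 t; rewrite !mul1r => hs hc.
by rewrite /symbol_re /symbol_im hC hS hs hc; split; ring.
Qed.

(** Up to 4 n g_n, the truncated symbol lies in the sector. The symbols at t and
    2 pi - t are complex conjugates, which reduces to angles at most pi. *)
Lemma symbol_approx (R : realType) (a t : R) (a1 : 1 < a) (a2 : a < 2) n :
  0 < t < pi *+ 2 -> (1 < n)%N ->
  exists A B : R, [/\ 0 <= A,
    sin ((a - 1) * (pi / 2)) * `|B| <= cos ((a - 1) * (pi / 2)) * A,
    `|symbol_re a n t + A| <= 4 * (n%:R * gcoef a n) &
    `|symbol_im a n t + B| <= 4 * (n%:R * gcoef a n)].
Proof.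
move=> tin n1; wlog tpi : t tin / t <= pi.
  move=> H; have [/(H t tin)//|pit] := leP t pi.
  have [||A [B [A0 AB hA hB]]] := H (pi *+ 2 - t).
  - by clear a1 a2; move: tin => /andP[? ?]; rewrite mulr2n; apply/andP; split; lra.
  - by clear a1 a2; move: tin => /andP[? ?]; rewrite mulr2n; lra.
  have [hr hi] := symbol_reflect a n t.
  exists A, (- B); split; rewrite ?normrN//; first by rewrite -hr.
  by move: hB; rewrite hi -normrN opprD opprK.
have tin1 : 0 < t <= pi by case/andP: tin => ->.
have tin2 : 0 <= t <= pi by case/andP: tin1 => /ltW ->.
have [m [m0 hC hS]] := symbol_direction a1 a2 tin1 n1.
have [] := symbol_sector a1 a2 tin2; move: hC hS => /=.
set om := a / 2 * (t - pi); rewrite -/(symbol_cos a n t) -/(symbol_sin a n t).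
move=> hC hS; rewrite cosB sinB.
set A := - _; set B := - _ => A0 B0 AB.
exists (m * A), (m * B); split.
- exact: mulr_ge0.
- by rewrite normrM !(ger0_norm) // mulrCA [leRHS]mulrCA ler_wpM2l.
- have -> : symbol_re a n t + m * A =
     a / 2 * ((symbol_cos a n t - m * cos om) * cos t
              + (symbol_sin a n t - m * sin om) * sin t)
     + (2 - a) / 2 * (symbol_cos a n t - m * cos om).
    by rewrite /symbol_re /A; ring.
  move: hC hS; move: (symbol_cos a n t - _) (symbol_sin a n t - _).
  move: (_ * gcoef a n) => b x y hx hy.
  have hxc : `|x * cos t| <= 2 * b.
    by rewrite normrM; apply: le_trans hx; apply: ler_piMr => //; exact: cos_max.
  have hys : `|y * sin t| <= 2 * b.
    by rewrite normrM; apply: le_trans hy; apply: ler_piMr => //; exact: sin_max.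
  move: hx hxc hys; move: (x * cos t) (y * sin t) => p q.
  rewrite !ler_norml => /andP[h1 h2] /andP[h3 h4] /andP[h5 h6].
  by clear -a1 a2 h1 h2 h3 h4 h5 h6; apply/andP; split; nra.
- have -> : symbol_im a n t + m * B =
     a / 2 * ((symbol_sin a n t - m * sin om) * cos t
              - (symbol_cos a n t - m * cos om) * sin t)
     + (2 - a) / 2 * (symbol_sin a n t - m * sin om).
    by rewrite /symbol_im /B; ring.
  move: hC hS; move: (symbol_cos a n t - _) (symbol_sin a n t - _).
  move: (_ * gcoef a n) => b x y hx hy.
  have hxc : `|y * cos t| <= 2 * b.
    by rewrite normrM; apply: le_trans hy; apply: ler_piMr => //; exact: cos_max.
  have hys : `|x * sin t| <= 2 * b.
    by rewrite normrM; apply: le_trans hx; apply: ler_piMr => //; exact: sin_max.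
  move: hy hxc hys; move: (y * cos t) (x * sin t) => p q.
  rewrite !ler_norml => /andP[h1 h2] /andP[h3 h4] /andP[h5 h6].
  by clear -a1 a2 h1 h2 h3 h4 h5 h6; apply/andP; split; nra.
Qed.

(** * The numerical range of the Toeplitz matrix *)

(** The integrand of the sector bound, for Fourier transforms x1 + i x2 and
    y1 + i y2 and a symbol fr + i fi within [d] of - A - i B. For the exact symbol,
    replacing [s * B] by [k * A] turns the difference of the two sides into A times
    a sum of two squares, because s^2 + k^2 = 1. *)
Lemma sector_quad (R : realType) (s k fr fi A B d x1 x2 y1 y2 : R) :
  0 <= s <= 1 -> 0 <= k -> s ^+ 2 + k ^+ 2 = 1 ->
  0 <= A -> s * `|B| <= k * A -> `|fr + A| <= d -> `|fi + B| <= d ->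
  2 * s * (fr * (x1 * y1 + x2 * y2) - fi * (x1 * y2 - x2 * y1)) <=
    - fr * (x1 ^+ 2 + x2 ^+ 2) - fr * (y1 ^+ 2 + y2 ^+ 2)
    + 3 * d * (x1 ^+ 2 + x2 ^+ 2 + y1 ^+ 2 + y2 ^+ 2).
Proof.
move=> /andP[s0 s1] k0 sk A0 sB hr hi.
pose X := x1 * y1 + x2 * y2; pose Y := x1 * y2 - x2 * y1.
pose N := x1 ^+ 2 + x2 ^+ 2 + y1 ^+ 2 + y2 ^+ 2.
have N0 : 0 <= N by rewrite !addr_ge0 ?sqr_ge0.
have d0 : 0 <= d by exact: le_trans hr.
have XN : 2 * `|X| <= N.
  have [_|_] := ger0P X.
    have := sqr_ge0 (x1 - y1); have := sqr_ge0 (x2 - y2); rewrite /X /N; lra.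
  have := sqr_ge0 (x1 + y1); have := sqr_ge0 (x2 + y2); rewrite /X /N; lra.
have YN : 2 * `|Y| <= N.
  have [_|_] := ger0P Y.
    have := sqr_ge0 (x1 - y2); have := sqr_ge0 (x2 + y1); rewrite /Y /N; lra.
  have := sqr_ge0 (x1 + y2); have := sqr_ge0 (x2 - y1); rewrite /Y /N; lra.
have key : 2 * (- s * X + k * `|Y|) <= N.
  have sN e : e ^+ 2 = 1 -> 2 * (- s * X + k * (e * Y)) <= N.
    move=> ee; rewrite -subr_ge0.
    have -> : N - 2 * (- s * X + k * (e * Y)) =
      (x1 + s * y1 - e * k * y2) ^+ 2 + (x2 + s * y2 + e * k * y1) ^+ 2.
      transitivity (x1 ^+ 2 + x2 ^+ 2 + (s ^+ 2 + e ^+ 2 * k ^+ 2) * (y1 ^+ 2 + y2 ^+ 2)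
        - 2 * (- s * X + k * (e * Y))); last by rewrite /X /Y; ring.
      by rewrite ee mul1r sk /N; ring.
    by rewrite addr_ge0 ?sqr_ge0.
  have [_|_] := ger0P Y.
    by have := sN 1 (expr1n _ 2); rewrite mul1r.
  have n1 : (-1) ^+ 2 = 1 :> R by rewrite sqrrN expr1n.
  by have := sN (-1) n1; rewrite mulN1r.
have exact_part : 2 * s * (- A * X + B * Y) <= A * N.
  have h1 : s * (B * Y) <= k * A * `|Y|.
    apply: (@le_trans _ _ (s * `|B| * `|Y|)); last exact: ler_wpM2r.
    by rewrite -mulrA; apply: ler_wpM2l => //; rewrite -normrM ler_norm.
  by have := ler_wpM2l A0 key; lra.
have err x y : `|x| <= d -> 2 * `|y| <= N -> 2 * s * (x * y) <= d * N.
  move=> hx hy; apply: (@le_trans _ _ (s * (`|x| * (2 * `|y|)))).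
    have := ler_norm (x * y); rewrite normrM => h.
    have := ler_wpM2l s0 h; lra.
  apply: (@le_trans _ _ (1 * (d * N))); last by rewrite mul1r.
  by apply: ler_pM => //; apply: ler_pM.
have e1 := err _ _ hr XN.
have hY' : 2 * `|- Y| <= N by rewrite normrN.
have e2 := err _ _ hi hY'.
have e3 : 0 <= (d - (fr + A)) * N.
  by rewrite mulr_ge0// subr_ge0; apply: le_trans (ler_norm _) hr.
by move: exact_part e1 e2 e3; rewrite -/X -/Y /N; lra.
Qed.

(** The midpoints of the L equal parts of [0, 2 pi]. The angle 0, where the phase
    of the symbol is undefined, is avoided, and still the average of
    cos (d t) over this grid vanishes for 0 < d < L. *)
Definition midgrid (R : realType) (L l : nat) : R := (l.*2.+1)%:R * (pi / L%:R).

Lemma midgrid_in (R : realType) L (l : 'I_L) : 0 < midgrid R L l < pi *+ 2.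
Proof.
have p0 := pi_gt0 R.
have L0 : 0 < L%:R :> R by rewrite ltr0n (leq_ltn_trans _ (ltn_ord l)).
apply/andP; split; first by rewrite /midgrid mulr_gt0// divr_gt0.
rewrite /midgrid mulrA ltr_pdivrMr//.
have -> : pi *+ 2 * L%:R = L.*2%:R * pi :> R by rewrite -mul2n natrM mulr2n; ring.
by rewrite ltr_pM2r// ltr_nat; have := ltn_ord l; lia.
Qed.

Lemma sum_cos_midgrid (R : realType) L d :
  (0 < d < L)%N ->
  \sum_(l < L) cos (d%:R * midgrid R L l) = 0.
Proof.
move=> /andP[d0 dL].
have p0 := pi_gt0 R.
have L0 : 0 < L%:R :> R by rewrite ltr0n; lia.
pose h : R := d%:R * (pi / L%:R).
(* Multiplied by 2 sin h, the sum telescopes. *)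
have sh : 0 < sin h.
  apply: sin_gt0_pi; apply/andP; split; first by rewrite mulr_gt0 ?ltr0n// divr_gt0.
  by rewrite /h mulrA ltr_pdivrMr// mulrC ltr_pM2l// ltr_nat.
apply: (mulfI (_ : 2 * sin h != 0)); first by rewrite mulf_neq0// gt_eqF.
rewrite mulr0 mulr_sumr.
transitivity (\sum_(0 <= l < L) (sin (l.+1.*2%:R * h) - sin (l.*2%:R * h))).
  rewrite big_mkord; apply: eq_bigr => l _.
  have -> : d%:R * midgrid R L l = l.*2%:R * h + h.
    by rewrite /midgrid /h -(natr1 l.*2); ring.
  have -> : l.+1.*2%:R * h = (l.*2%:R * h + h) + h.
    by rewrite doubleS -!natr1; ring.
  have -> : l.*2%:R * h = (l.*2%:R * h + h) - h by ring.
  move: (l.*2%:R * h) => y.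
  have -> : y + h - h + h = y + h by ring.
  by rewrite (sinD (y + h)) (sinB (y + h)); ring.
rewrite telescope_sumr// mul0r sin0 subr0.
have -> : L.*2%:R * h = 0 + pi *+ (d.*2).
  rewrite add0r -mulr_natl -!mul2n !natrM /h; field; by rewrite gt_eqF.
by rewrite (alternatingn (@sinDpi R)) sin0 mulr0.
Qed.

Lemma sum_cos_midgridB (R : realType) L p q :
  (p < L)%N -> (q < L)%N ->
  \sum_(l < L) cos ((p%:R - q%:R) * midgrid R L l) = (p == q)%:R * L%:R.
Proof.
move=> pL qL; have [->|pq] := eqVneq p q.
  under eq_bigr do rewrite subrr mul0r cos0.
  by rewrite sumr_const card_ord mul1r.
rewrite mul0r; wlog qp : p q pL qL pq / (q < p)%N.
  move=> H; have [qp|pq'|/eqP] := ltngtP q p; [exact: H| |by rewrite eq_sym (negbTE pq)].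
  rewrite -[RHS](H q p)//; last by rewrite eq_sym.
  by apply: eq_bigr => l _; rewrite -cosN -mulNr opprB.
under eq_bigr do rewrite -natrB 1?ltnW//.
apply: sum_cos_midgrid; lia.
Qed.

Lemma sum_pick (R : realType) n (F : nat -> R) j m :
  (m < n)%N ->
  \sum_(k < n) F k * ((k + j)%N == m)%:R = if (j <= m)%N then F (m - j)%N else 0.
Proof.
move=> mn; case: ifP => jm; last first.
  apply: big1 => k _; have -> : ((k + j)%N == m) = false by lia.
  by rewrite mulr0.
have kn : (m - j < n)%N by lia.
rewrite (bigD1 (Ordinal kn))//= subnK// eqxx mulr1 big1 ?addr0// => k.
rewrite -val_eqE/= => hk.
have -> : ((k + j)%N == m) = false by lia.
by rewrite mulr0.
Qed.

Definition Gform (R : realType) (a : R) M (u v : 'I_M -> R) : R :=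
  \sum_i \sum_j u i * Gmx a M i j * v j.

(** The real part of the truncated symbol times e^(i (j - i) t), expanded: its
    average over the angles is the entry (i, j) of [Gmx]. *)
Definition symbol_kernel (R : realType) (a : R) n (t : R) (i j : nat) : R :=
  \sum_(k < n) gcoef a k * (a / 2 * cos (((k + j)%:R - i.+1%:R) * t)
                     + (2 - a) / 2 * cos (((k + j)%:R - i%:R) * t)).

Lemma sum_symbol_kernel (R : realType) (a : R) n L M (i j : 'I_M) :
  (M < n)%N -> (n + M < L)%N ->
  \sum_(l < L) symbol_kernel a n (midgrid R L l) i j = L%:R * Gmx a M i j.
Proof.
move=> Mn nL; rewrite exchange_big/=.
have iM := ltn_ord i; have jM := ltn_ord j.
transitivity (\sum_(k < n) L%:R * (a / 2 * (gcoef a k * ((k + j)%N == i.+1)%:R)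
      + (2 - a) / 2 * (gcoef a k * ((k + j)%N == i :> nat)%:R))).
  apply: eq_bigr => k _; have kn := ltn_ord k.
  rewrite -mulr_sumr big_split/= -!mulr_sumr !sum_cos_midgridB; [|lia..].
  by ring.
rewrite -mulr_sumr big_split/= -!mulr_sumr.
rewrite (sum_pick (gcoef a)); last by lia.
rewrite (sum_pick (gcoef a)); last by lia.
congr (_ * _); rewrite mxE.
case: (leqP j i) => ji.
  by rewrite (leqW ji) subSn.
rewrite mulr0 addr0; case: ifP => ji'; last by rewrite mulr0.
have -> : (j = i.+1 :> nat) by lia.
by rewrite subnn.
Qed.

Definition cos_sum (R : realType) M (u : 'I_M -> R) (t : R) : R :=
  \sum_i u i * cos (i%:R * t).
Definition sin_sum (R : realType) M (u : 'I_M -> R) (t : R) : R :=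
  \sum_i u i * sin (i%:R * t).

Lemma symbol_kernelE (R : realType) (a : R) n (t : R) i j :
  symbol_kernel a n t i j =
    symbol_re a n t *
      (cos (i%:R * t) * cos (j%:R * t) + sin (i%:R * t) * sin (j%:R * t))
  - symbol_im a n t *
      (cos (i%:R * t) * sin (j%:R * t) - sin (i%:R * t) * cos (j%:R * t)).
Proof.
set ci := cos (i%:R * t); set cj := cos (j%:R * t).
set si := sin (i%:R * t); set sj := sin (j%:R * t).
pose X := ci * cj + si * sj; pose Y := ci * sj - si * cj.
rewrite -/X -/Y.
transitivity (\sum_(k < n) ((a / 2 * (cos t * X + sin t * Y) + (2 - a) / 2 * X) *
       (gcoef a k * cos (k%:R * t)) +
     (a / 2 * (sin t * X - cos t * Y) - (2 - a) / 2 * Y) *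
       (gcoef a k * sin (k%:R * t)))); last first.
  rewrite big_split/= -!mulr_sumr -/(symbol_cos a n t) -/(symbol_sin a n t).
  by rewrite /symbol_re /symbol_im; ring.
apply: eq_bigr => k _.
have -> : ((k + j)%:R - i.+1%:R) * t = (k%:R * t - t) + (j%:R * t - i%:R * t).
  by rewrite natrD -natr1; ring.
have -> : ((k + j)%:R - i%:R) * t = k%:R * t + (j%:R * t - i%:R * t).
  by rewrite natrD; ring.
rewrite (cosD (k%:R * t - t)) (cosB _ t) (sinB _ t) (cosD (k%:R * t)).
rewrite (cosB (j%:R * t)) (sinB (j%:R * t)) -/ci -/cj -/si -/sj /X /Y.
by ring.
Qed.

Lemma symbol_kernel_form (R : realType) (a : R) n (t : R) M (u v : 'I_M -> R) :
  \sum_(i < M) \sum_(j < M) u i * symbol_kernel a n t i j * v j =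
    symbol_re a n t * (cos_sum u t * cos_sum v t + sin_sum u t * sin_sum v t)
  - symbol_im a n t * (cos_sum u t * sin_sum v t - sin_sum u t * cos_sum v t).
Proof.
rewrite /cos_sum /sin_sum !big_distrlr/=.
rewrite -!big_split/= -sumrN -!big_split/= !mulr_sumr -sumrN -big_split/=.
apply: eq_bigr => i _.
rewrite -!big_split/= -sumrN -!big_split/= !mulr_sumr -sumrN -big_split/=.
by apply: eq_bigr => j _; rewrite symbol_kernelE; ring.
Qed.

Lemma trig_sum_sqr_le (R : realType) M (u : 'I_M -> R) (t : R) :
  cos_sum u t ^+ 2 + sin_sum u t ^+ 2 <= 2 * (\sum_i `|u i|) ^+ 2.
Proof.
have S0 : 0 <= \sum_i `|u i| by apply: sumr_ge0.
have h f : (forall i : 'I_M, `|f i| <= 1) ->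
    (\sum_i u i * f i) ^+ 2 <= (\sum_i `|u i|) ^+ 2.
  move=> hf; rewrite -(real_normK (num_real (\sum_i u i * f i))).
  rewrite lerXn2r ?nnegrE//; apply: le_trans (ler_norm_sum _ _ _) _.
  by apply: ler_sum => i _; rewrite normrM; apply: ler_piMr.
have := h (fun i => cos (i%:R * t)) (fun i => cos_max _).
have := h (fun i => sin (i%:R * t)) (fun i => sin_max _).
by rewrite -/(cos_sum u t) -/(sin_sum u t); lra.
Qed.

(** [sector_quad] for the truncated symbol, averaged over a grid fine enough for
    the average to be exact on the trigonometric polynomials involved. *)
Lemma Gform_sector (R : realType) (a : R) (a1 : 1 < a) (a2 : a < 2)
    M (u v : 'I_M -> R) :
  2 * sin ((a - 1) * (pi / 2)) * Gform a u v <= - Gform a u u - Gform a v v.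
Proof.
pose s := sin ((a - 1) * (pi / 2)); pose k := cos ((a - 1) * (pi / 2)).
rewrite -/s.
have ang : 0 <= (a - 1) * (pi / 2) <= pi / 2.
  have p0 : 0 <= pi / 2 :> R by rewrite divr_ge0// pi_ge0.
  apply/andP; split; first by rewrite mulr_ge0// subr_ge0 ltW.
  by rewrite ler_piMl//; clear p0; lra.
have s01 : 0 <= s <= 1.
  rewrite sin_le1 andbT; apply: sin_ge0_pi; move: ang => /andP[-> h2]/=.
  by apply: (le_trans h2); have := pi_ge0 R; clear; lra.
have k0 : 0 <= k.
  apply: cos_ge0_pihalf; move: ang => /andP[h1 ->]; rewrite andbT.
  by apply: le_trans h1; rewrite oppr_le0 divr_ge0// pi_ge0.
have sk : s ^+ 2 + k ^+ 2 = 1 by rewrite addrC cos2Dsin2.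
pose W := 2 * (\sum_i `|u i|) ^+ 2 + 2 * (\sum_i `|v i|) ^+ 2.
have W0 : 0 <= W by rewrite addr_ge0// mulr_ge0// sqr_ge0.
have step n : (M < n)%N -> (1 < n)%N ->
    2 * s * Gform a u v <=
      - Gform a u u - Gform a v v + 12 * (n%:R * gcoef a n) * W.
  move=> Mn n1; pose L := (n + M).+1.
  have b0 : 0 <= n%:R * gcoef a n.
    by case: n n1 {Mn L} => [|[|n]]// _; rewrite mulr_ge0// ltW// gcoef_gt0.
  have L0 : 0 < L%:R :> R by [].
  have GE (x y : 'I_M -> R) : L%:R * Gform a x y =
      \sum_(l < L) \sum_(i < M) \sum_(j < M)
        x i * symbol_kernel a n (midgrid R L l) i j * y j.
    rewrite exchange_big/= mulr_sumr; apply: eq_bigr => i _.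
    rewrite exchange_big/= mulr_sumr; apply: eq_bigr => j _.
    by rewrite -mulr_suml -mulr_sumr sum_symbol_kernel// /L; ring.
  rewrite -(ler_pM2l L0).
  have -> : L%:R * (2 * s * Gform a u v) = 2 * s * (L%:R * Gform a u v) by ring.
  have -> : L%:R * (- Gform a u u - Gform a v v + 12 * (n%:R * gcoef a n) * W) =
    - (L%:R * Gform a u u) - L%:R * Gform a v v
    + \sum_(l < L) 12 * (n%:R * gcoef a n) * W.
    by rewrite sumr_const card_ord -[_ *+ L]mulr_natl; ring.
  rewrite !GE mulr_sumr -!sumrN -!big_split/=; apply: ler_sum => l _.
  rewrite !symbol_kernel_form.
  have [A [B [A0 AB hA hB]]] := symbol_approx a1 a2 (midgrid_in R l) n1.
  have := sector_quad (cos_sum u (midgrid R L l)) (sin_sum u (midgrid R L l))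
    (cos_sum v (midgrid R L l)) (sin_sum v (midgrid R L l)) s01 k0 sk A0 AB hA hB.
  have := trig_sum_sqr_le u (midgrid R L l); have := trig_sum_sqr_le v (midgrid R L l).
  rewrite /W; move: (\sum_i `|u i|) (\sum_i `|v i|) b0 => su sv.
  move: (cos_sum u _) (sin_sum u _) (cos_sum v _) (sin_sum v _).
  move: (symbol_re _ _ _) (symbol_im _ _ _) (_ * gcoef _ _).
  move=> fr fi b c1 c2 c3 c4 b0 hv hu.
  have := ler_wpM2l b0 hv; have := ler_wpM2l b0 hu.
  by clear; lra.
(* The truncation error 12 n g_n W vanishes as n grows. *)
apply/ler_addgt0Pr => e e0.
pose B := (M + Num.bound (24 * W / e))%N.
have hB : 24 * W / e < B.+1%:R.
  apply: lt_le_trans (archi_boundP _) _; first by rewrite !mulr_ge0// invr_ge0 ltW.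
  by rewrite ler_nat /B; lia.
rewrite ltr_pdivrMr// in hB.
have m0 : 0 < B.+1%:R :> R by [].
have MB : (M < B.+2)%N by rewrite /B; lia.
have dec := ler_wpM2l W0 (gcoef_decay a1 a2 B).
apply: (le_trans (step _ MB isT)); rewrite lerD2l -(ler_pM2l m0).
move: (B.+2%:R * gcoef a B.+2) dec hB => b; move: (B.+1%:R : R) => m.
by clear; lra.
Qed.

(** * Multiplication by a convex function *)

(** Bounding each off-diagonal product v_i v_j by (v_i^2 + v_j^2) / 2 leaves the
    squares weighted by the row sums. *)
Lemma quad_le0_of_rowsum_le0 (R : realType) n (K : 'I_n -> 'I_n -> R)
    (v : 'I_n -> R) :
  (forall i j, K i j = K j i) -> (forall i j, i != j -> 0 <= K i j) ->
  (forall i, \sum_j K i j <= 0) ->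
  \sum_i \sum_j v i * K i j * v j <= 0.
Proof.
move=> Ksym Koff Krow.
have h1 : \sum_i \sum_j v i * K i j * v j <=
          \sum_i \sum_j (v i ^+ 2 * K i j + K i j * v j ^+ 2) / 2.
  apply: ler_sum => i _; apply: ler_sum => j _.
  have [->|/Koff] := eqVneq i j.
    by rewrite le_eqVlt; apply/orP; left; apply/eqP; field.
  by have := sqr_ge0 (v i - v j); nra.
apply: le_trans h1 _.
have -> : \sum_i \sum_j (v i ^+ 2 * K i j + K i j * v j ^+ 2) / 2 =
          \sum_i v i ^+ 2 * \sum_j K i j.
  under eq_bigr do rewrite -mulr_suml big_split/=.
  rewrite -mulr_suml big_split/= [X in _ + X]exchange_big/=.
  have -> : \sum_j \sum_i K i j * v j ^+ 2 = \sum_j \sum_i v j ^+ 2 * K j i.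
    by apply: eq_bigr => j _; apply: eq_bigr => i _; rewrite mulrC Ksym.
  under [RHS]eq_bigr do rewrite mulr_sumr.
  by field.
by apply: sumr_le0 => i _; rewrite mulr_ge0_le0 ?sqr_ge0.
Qed.

(** The entry of G + G^T at distance k >= 1 from the diagonal. *)
Definition sym_weight (R : realType) (a : R) (k : nat) : R :=
  wcoef a k.+1 + (if k == 1%N then wcoef a 0 else 0).

Lemma sym_weight_ge0 (R : realType) (a : R) (a1 : 1 < a) (a2 : a < 2) k :
  0 <= sym_weight a k.+1.
Proof.
rewrite /sym_weight; case: k => [|k].
  by rewrite addrC wcoef02_ge0.
by rewrite addr0 wcoef_ge0.
Qed.

Lemma sym_weight_sum (R : realType) (a : R) (a1 : 1 < a) (a2 : a < 2) n :
  \sum_(1 <= k < n.+2) sym_weight a k <= - wcoef a 1.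
Proof.
have := wcoef_sum_le0 a1 a2 n.
rewrite -(big_mkord xpredT) big_nat_recl// big_nat_recl//.
move=> h.
have e1 : \sum_(1 <= k < n.+2) (if k == 1%N then wcoef a 0 else 0) = wcoef a 0.
  rewrite big_ltn// eqxx big_nat_cond big1 ?addr0// => k.
  by case: k => [|[|k]].
rewrite /sym_weight big_split/= e1 big_add1/=; lra.
Qed.

Lemma Gmx_sym (R : realType) (a : R) n (i j : 'I_n) :
  Gmx a n i j + Gmx a n j i =
    if i == j then 2 * wcoef a 1 else sym_weight a (maxn i j - minn i j).
Proof.
rewrite !mxE; have [->|ij] := eqVneq i j.
  by rewrite leqnSn subSnn; ring.
wlog lij : i j ij / (i < j)%N.
  move=> H; case: (boolP (i < j)%N) => [|]; first exact: H.
  rewrite -leqNgt => ji.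
  rewrite addrC maxnC minnC; apply: H; first by rewrite eq_sym.
  by rewrite ltn_neqAle ji eq_sym andbT; apply: contraNneq ij => h; apply/eqP/val_inj.
rewrite (maxn_idPr (ltnW lij)) (minn_idPl (ltnW lij)).
rewrite (leqW (ltnW lij)) (subSn (ltnW lij)) /sym_weight [LHS]addrC; congr (_ + _).
rewrite leq_eqVlt ltnS leqNgt lij orbF.
have -> : (j - i == 1)%N = (j == i.+1 :> nat) by lia.
by case: eqP => // ->; rewrite subnn.
Qed.

(** Row i of the symmetrised matrix pairs the entries at distance k to the left and
    to the right, both with the weight [sym_weight a k], and the diagonal is at
    most minus the sum of all these weights. So it suffices that for each k the
    two coefficients 2 - p_i p_(i - k) and 2 - p_i p_(i + k) add up to at most
    2 (2 - p_i^2). If both neighbours exist, this is p_i times the midpoint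
    convexity of p; if one is missing, it follows from p_i <= 1. *)
Lemma Gmx_convex_rowsums (R : realType) (a : R) (a1 : 1 < a) (a2 : a < 2) n
    (p v : 'I_n -> R) :
  (forall i, 0 <= p i <= 1) ->
  (forall i j k : 'I_n, (i + k = j.*2)%N -> 2 * p j <= p i + p k) ->
  \sum_i \sum_j v i * ((2 - p i * p j) * Gmx a n i j) * v j <= 0.
Proof.
move=> p01 pconv.
pose K i j := (2 - p i * p j) * (Gmx a n i j + Gmx a n j i) / 2.
have -> : \sum_i \sum_j v i * ((2 - p i * p j) * Gmx a n i j) * v j =
          \sum_i \sum_j v i * K i j * v j.
  have e2 : \sum_i \sum_j v i * ((2 - p i * p j) * Gmx a n i j) * v j =
     \sum_i \sum_j v i * ((2 - p i * p j) * Gmx a n j i) * v j.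
    by rewrite exchange_big/=; apply: eq_bigr => i _; apply: eq_bigr => j _; ring.
  have -> : \sum_i \sum_j v i * K i j * v j =
   (\sum_i \sum_j v i * ((2 - p i * p j) * Gmx a n i j) * v j +
     \sum_i \sum_j v i * ((2 - p i * p j) * Gmx a n j i) * v j) / 2.
    rewrite -big_split/= mulr_suml; apply: eq_bigr => i _.
    rewrite -big_split/= mulr_suml; apply: eq_bigr => j _.
    by rewrite /K; field.
  by rewrite -e2; field.
apply: quad_le0_of_rowsum_le0.
- by move=> i j; rewrite /K; field.
- move=> i j ij; rewrite /K Gmx_sym (negbTE ij).
  have w0 : 0 <= sym_weight a (maxn i j - minn i j).
    have : (0 < maxn i j - minn i j)%N by move: ij; rewrite -val_eqE/=; lia.
    by case: (_ - _)%N => // m _; exact: sym_weight_ge0.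
  have := p01 i; have := p01 j; move=> /andP[? ?] /andP[? ?].
  by rewrite mulr_ge0// mulr_ge0//; nra.
move=> i.
have H := sym_weight_sum a1 a2 n.
have pi01 := p01 i.
(* [p] as a function on all natural numbers, to reindex rows by the distance k. *)
pose q k := if insub k is Some j then p j else 0.
have qE j : q (nat_of_ord j) = p j by rewrite /q valK.
have eL : \sum_(j < n | (j < i)%N) (2 - p i * p j) * sym_weight a (i - j) =
   \sum_(1 <= k < n.+2)
     sym_weight a k * (if (k <= i)%N then 2 - p i * q (i - k)%N else 0).
  pose F j := (2 - p i * q j) * sym_weight a (i - j).
  transitivity (\sum_(j < n | (j < i)%N) F j).
    by apply: eq_bigr => j _; rewrite /F qE.
  rewrite -(big_mkord (fun j => j < i)%N).
  rewrite -(big_nat_widen _ _ _ xpredT) ?(ltnW (ltn_ord i))//.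
  rewrite [RHS](big_cat_nat (n := i.+1))//=; last by have := ltn_ord i; lia.
  rewrite [X in _ = _ + X]big_nat_cond [X in _ = _ + X]big1 ?addr0; last first.
    by move=> k /andP[/andP[ik _] _]; rewrite leqNgt ik mulr0.
  rewrite big_nat_rev big_add1 big_nat_cond [RHS]big_nat_cond; apply: eq_bigr => k.
  by move=> /andP[/andP[_ ki] _]; rewrite /F add0n ki mulrC subKn.
have eR : \sum_(j < n | (i < j)%N) (2 - p i * p j) * sym_weight a (j - i) =
   \sum_(1 <= k < n.+2)
     sym_weight a k * (if (k + i < n)%N then 2 - p i * q (k + i)%N else 0).
  pose F j := (2 - p i * q j) * sym_weight a (j - i).
  transitivity (\sum_(j < n | (i < j)%N) F j).
    by apply: eq_bigr => j _; rewrite /F qE.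
  rewrite -(big_mkord (fun j => i < j)%N) -(big_nat_widenl i.+1 0 n xpredT)//.
  rewrite -add1n big_addn.
  rewrite [RHS](big_cat_nat (n := (n - i)%N))//=; last 2 first.
  - by rewrite subn_gt0.
  - by lia.
  rewrite [X in _ = _ + X]big_nat_cond [X in _ = _ + X]big1 ?addr0; last first.
    move=> k /andP[/andP[ik _] _].
    have -> : (k + i < n)%N = false by lia.
    exact: mulr0.
  rewrite big_nat_cond [RHS]big_nat_cond; apply: eq_bigr => k.
  move=> /andP[/andP[_ ki] _]; rewrite /F addnK mulrC.
  have -> : (k + i < n)%N = true by lia.
  done.
have -> : \sum_j K i j = ((2 - p i * p i) * (2 * wcoef a 1) +
     (\sum_(j < n | (j < i)%N) (2 - p i * p j) * sym_weight a (i - j)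
     + \sum_(j < n | (i < j)%N) (2 - p i * p j) * sym_weight a (j - i))) / 2.
  rewrite (bigD1 i)//= /K Gmx_sym eqxx [RHS]mulrDl; congr (_ + _).
  rewrite (bigID (fun j : 'I_n => (j < i)%N))/= [RHS]mulrDl; congr (_ + _).
    rewrite mulr_suml; apply: eq_big => [j|j /andP[ij ji]].
      by rewrite andb_idl// => h; rewrite -val_eqE neq_ltn h.
    rewrite Gmx_sym eq_sym (negbTE ij).
    by rewrite (maxn_idPl (ltnW ji)) (minn_idPr (ltnW ji)).
  rewrite mulr_suml; apply: eq_big => [j|j /andP[ij ji]].
    by rewrite -val_eqE -leqNgt ltn_neqAle eq_sym.
  rewrite -leqNgt in ji.
  by rewrite Gmx_sym eq_sym (negbTE ij) (maxn_idPr ji) (minn_idPl ji).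
rewrite eL eR -big_split/=.
suff : \sum_(1 <= k < n.+2) (sym_weight a k *
       (if (k <= i)%N then 2 - p i * q (i - k)%N else 0) +
    sym_weight a k * (if (k + i < n)%N then 2 - p i * q (k + i)%N else 0)) <=
    \sum_(1 <= k < n.+2) 2 * (2 - p i ^+ 2) * sym_weight a k.
  rewrite -mulr_sumr; move: H; move: pi01 => /andP[? ?].
  set S := \sum_(1 <= k < n.+2) sym_weight a k; set T := \sum_(_ <= _ < _) _.
  move=> h1 h2.
  have : 0 <= (2 - p i ^+ 2) * (- wcoef a 1 - S) by rewrite mulr_ge0//; nra.
  by lra.
rewrite big_nat_cond [leRHS]big_nat_cond; apply: ler_sum => -[|k]// /andP[/andP[_ kn] _].
rewrite -mulrDr [leRHS]mulrC; apply: ler_wpM2l; first exact: sym_weight_ge0.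
have q0 m : 0 <= q m.
  by rewrite /q; case: insubP => // j _ _; have /andP[] := p01 j.
move: pi01 => /andP[p0 p1].
have pqL := mulr_ge0 p0 (q0 (i - k.+1)%N).
have pqR := mulr_ge0 p0 (q0 (k.+1 + i)%N).
have pp : p i ^+ 2 <= 1 by rewrite expr_le1.
case: (boolP (k.+1 + i < n)%N) => kin; case: (boolP (k < i)%N) => ki; [|by lra..].
have := pconv (Ordinal (leq_ltn_trans (leq_subr k.+1 i) (ltn_ord i))) i
  (Ordinal kin).
rewrite -!qE /= => H2; have /H2 {}H2 : (i - k.+1 + (k.+1 + i) = i.*2)%N by lia.
have := ler_wpM2l p0 H2.
by rewrite qE; lra.
Qed.

Lemma Gform_le0 (R : realType) (a : R) (a1 : 1 < a) (a2 : a < 2)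
    M (v : 'I_M -> R) :
  Gform a v v <= 0.
Proof.
suff : 2 * Gform a v v <= 0 by rewrite pmulr_rle0.
have -> : 2 * Gform a v v =
    \sum_i \sum_j v i * ((2 - 0 * 0) * Gmx a M i j) * v j.
  rewrite mulr_sumr; apply: eq_bigr => i _; rewrite mulr_sumr.
  by apply: eq_bigr => j _; ring.
apply: (@Gmx_convex_rowsums R a a1 a2 M (fun=> 0) v) => [i|i j k _].
  by rewrite lexx ler01.
by rewrite mulr0 addr0.
Qed.

Lemma Gform_contraction (R : realType) (a : R) (a1 : 1 < a) (a2 : a < 2)
    M (p v : 'I_M -> R) :
  (forall i, 0 <= p i <= 1) ->
  (forall i j k : 'I_M, (i + k = j.*2)%N -> 2 * p j <= p i + p k) ->
  2 * Gform a v v <= Gform a (fun i => p i * v i) (fun i => p i * v i).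
Proof.
move=> p01 pc; rewrite -subr_le0.
rewrite [leLHS](_ : _ =
    \sum_i \sum_j v i * ((2 - p i * p j) * Gmx a M i j) * v j).
  exact: Gmx_convex_rowsums.
rewrite mulr_sumr -sumrB; apply: eq_bigr => i _.
by rewrite mulr_sumr -sumrB; apply: eq_bigr => j _; ring.
Qed.

Lemma Gform_scale (R : realType) (a c : R) M (u v : 'I_M -> R) :
  Gform a (fun i => c * u i) v = c * Gform a u v.
Proof.
rewrite mulr_sumr; apply: eq_bigr => i _; rewrite mulr_sumr.
by apply: eq_bigr => j _; ring.
Qed.

Lemma Gform_scale2 (R : realType) (a c : R) M (u : 'I_M -> R) :
  Gform a (fun i => c * u i) (fun i => c * u i) = c ^+ 2 * Gform a u u.
Proof.
rewrite mulr_sumr; apply: eq_bigr => i _; rewrite mulr_sumr.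
by apply: eq_bigr => j _; ring.
Qed.

(** The sector bound with u = c / sqrt 2 times p v, the scaling for which the two
    terms on its right-hand side have equal bounds. *)
Lemma Gform_multiplier (R : realType) (a c : R) (a1 : 1 < a) (a2 : a < 2)
    M (p v : 'I_M -> R) :
  (forall i, 0 <= p i <= 1) ->
  (forall i j k : 'I_M, (i + k = j.*2)%N -> 2 * p j <= p i + p k) ->
  c ^+ 2 = 1 ->
  sin ((a - 1) * (pi / 2)) * (c * Gform a (fun i => p i * v i) v)
    <= - (Num.sqrt 2 * Gform a v v).
Proof.
move=> p01 pc c1.
pose t : R := c / Num.sqrt 2.
have s2 : 0 < Num.sqrt 2 :> R by rewrite sqrtr_gt0.
have s22 : Num.sqrt 2 ^+ 2 = 2 :> R by rewrite sqr_sqrtr.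
have t2 : t ^+ 2 = 2^-1 by rewrite exprMn c1 exprVn s22 mul1r.
have := Gform_sector a1 a2 (fun i => t * (p i * v i)) v.
rewrite Gform_scale Gform_scale2 t2.
have := Gform_contraction a1 a2 v p01 pc.
have -> : c * Gform a (fun i => p i * v i) v
   = Num.sqrt 2 * (t * Gform a (fun i => p i * v i) v).
  by rewrite /t; field; rewrite gt_eqF.
move: (Gform a (fun i => p i * v i) v) (Gform a _ _) (Gform a v v) => x y z h1 h2.
rewrite mulrCA -mulrN ler_pM2l//; move: h1 h2; clear; lra.
Qed.

Lemma abs_cos_angle (R : realType) (a : R) (a1 : 1 < a) (a2 : a < 2) :
  0 < sin ((a - 1) * (pi / 2)) /\
  `|cos (a / 2 * pi)| = sin ((a - 1) * (pi / 2)).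
Proof.
have p0 := pi_gt0 R.
have s0 : 0 < sin ((a - 1) * (pi / 2)).
  apply: sin_gt0_pi; apply/andP; split.
    by rewrite mulr_gt0 ?subr_gt0// divr_gt0.
  rewrite mulrA ltr_pdivrMr// [ltRHS]mulrC ltr_pM2r//; clear p0; lra.
split=> //.
have -> : a / 2 * pi = (a - 1) * (pi / 2) + pi / 2 by field.
by rewrite cosDpihalf normrN gtr0_norm.
Qed.

Lemma Gform_coef_le0 (R : realType) (a kmin kmax k : R) (a1 : 1 < a) (a2 : a < 2)
    M (d v : 'I_M -> R) :
  0 <= kmin -> kmin <= kmax -> (forall i, kmin <= d i <= kmax) ->
  ((forall i j l : 'I_M, (i + l = j.*2)%N -> d i + d l <= 2 * d j) /\ k = kmax) \/
  ((forall i j l : 'I_M, (i + l = j.*2)%N -> 2 * d j <= d i + d l) /\ k = kmin) ->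
  0 <= k - Num.sqrt 2 * (kmax - kmin) / `|cos (a / 2 * pi)| ->
  Gform a (fun i => d i * v i) v <= 0.
Proof.
move=> k0 kk dk cvx; have [s0 ->] := abs_cos_angle a1 a2.
have G0 := Gform_le0 a1 a2 v.
have [D0 _|Dn0] := eqVneq (kmax - kmin) 0.
  have dE i : d i = kmin by apply/eqP; rewrite eq_le; have := dk i; lra.
  have -> : (fun i => d i * v i) = (fun i => kmin * v i) by apply/funext => i; rewrite dE.
  by rewrite Gform_scale mulr_ge0_le0.
have D0 : 0 < kmax - kmin by rewrite lt_neqAle eq_sym Dn0 subr_ge0.
(* The sign c makes the normalised p convex in both cases. *)
suff [c [p [c1 p01 pc dE]]] : exists c, exists p : 'I_M -> R, [/\ c ^+ 2 = 1,
    forall i, 0 <= p i <= 1,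
    forall i j l : 'I_M, (i + l = j.*2)%N -> 2 * p j <= p i + p l &
    forall i, d i = k + c * (kmax - kmin) * p i].
  move=> hk; have H := Gform_multiplier a1 a2 v p01 pc c1.
  have -> : Gform a (fun i => d i * v i) v =
     k * Gform a v v + (kmax - kmin) * (c * Gform a (fun i => p i * v i) v).
    rewrite !mulr_sumr -big_split/=; apply: eq_bigr => i _.
    rewrite !mulr_sumr -big_split/=; apply: eq_bigr => j _.
    by rewrite dE; ring.
  have H2 : 0 <= (k - Num.sqrt 2 * (kmax - kmin) / sin ((a - 1) * (pi / 2)))
                 * - Gform a v v.
    by rewrite mulr_ge0// oppr_ge0.
  move: H H2 s0; move: (sin _) (c * _) (Gform a v v) (Num.sqrt 2) => s x g r H H2 s0.
  have H3 : x <= - (r * g) / s by rewrite ler_pdivlMr// mulrC.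
  have := ler_wpM2l (ltW D0) H3.
  have -> : - (r * g) / s = - (r / s * g) by ring.
  move: H2.
  have -> : r * (kmax - kmin) / s = (kmax - kmin) * (r / s) by ring.
  by move: (r / s) (kmax - kmin) => q D; clear; lra.
have Di : 0 <= (kmax - kmin)^-1 by rewrite invr_ge0 ltW.
case: cvx => -[mid ->].
  exists (-1), (fun i => (kmax - d i) / (kmax - kmin)); split.
  - by rewrite sqrrN expr1n.
  - move=> i; rewrite ler_pdivrMr// mul1r mulr_ge0//=; have := dk i; lra.
  - move=> i j l /mid h; rewrite -mulrDl mulrA; apply: ler_wpM2r => //; lra.
  - by move=> i; field.
exists 1, (fun i => (d i - kmin) / (kmax - kmin)); split.
- by rewrite expr1n.
- move=> i; rewrite ler_pdivrMr// mul1r mulr_ge0//=; have := dk i; lra.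
- move=> i j l /mid h; rewrite -mulrDl mulrA; apply: ler_wpM2r => //; lra.
- by move=> i; field.
Qed.

(** * One grid line *)

Lemma midpoint_in (R : realType) (x y : R) : x < y -> (x + y) / 2 \in `]x, y[.
Proof. by move=> xy; rewrite in_itv/=; apply/andP; split; lra. Qed.

Lemma node_in (R : realType) (x y : R) M (i : 'I_M) :
  x < y ->
  node x y M i.+1 \in `]x, y[.
Proof.
move=> xy; have h0 : 0 < step x y M by rewrite divr_gt0// subr_gt0.
rewrite in_itv/= /node ltrDl mulr_gt0//=.
rewrite [ltRHS](_ : _ = x + M.+1%:R * step x y M); last first.
  by rewrite /step mulrC divfK// addrC subrK.
by rewrite ltrD2l ltr_pM2r// ltr_nat ltnS.
Qed.

Lemma convex_on_mid (R : realType) (x y : R) (f : R -> R) u v :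
  convex_on x y f -> u \in `]x, y[ -> v \in `]x, y[ ->
  2 * f ((u + v) / 2) <= f u + f v.
Proof.
move=> cf hu hv.
have h0 : 0 <= 2^-1 :> R by rewrite invr_ge0.
have h1 : 2^-1 <= 1 :> R by rewrite invf_le1// ler1n.
have conv : f (2^-1 * u + (1 - 2^-1) * v) <= 2^-1 * f u + (1 - 2^-1) * f v.
  by apply: (cf (Itv01 h0 h1) u v); rewrite inE.
move: conv; have -> : 2^-1 * u + (1 - 2^-1) * v = (u + v) / 2 by field.
by lra.
Qed.

Lemma node_mid (R : realType) (x y : R) M i j l :
  (i + l = j.*2)%N ->
  (node x y M i.+1 + node x y M l.+1) / 2 = node x y M j.+1.
Proof.
move=> ilj; rewrite /node.
have -> : j.+1%:R = (i.+1%:R + l.+1%:R) / 2 :> R.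
  have e : (i.+1 + l.+1 = j.+1 * 2)%N by lia.
  by rewrite -natrD e natrM mulfK.
by field.
Qed.

Lemma Gform_is_kappa_le0 (R : realType) (a kmin kmax k : R) (a1 : 1 < a) (a2 : a < 2)
    (xl xr : R) (f : R -> R) M (v : 'I_M -> R) :
  xl < xr ->
  (forall x, x \in `]xl, xr[ -> 0 <= kmin /\ kmin <= f x <= kmax) ->
  is_kappa xl xr f kmin kmax k ->
  0 <= k - Num.sqrt 2 * (kmax - kmin) / `|cos (a / 2 * pi)| ->
  Gform a (fun i => f (node xl xr M i.+1) * v i) v <= 0.
Proof.
move=> lr fk kap hk.
have [k0 fmid] := fk _ (midpoint_in lr).
apply: (Gform_coef_le0 (kmin := kmin) (kmax := kmax) (k := k) a1 a2) => //.
- by case/andP: fmid => h1 h2; exact: le_trans h2.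
- by move=> i; have [] := fk _ (node_in i lr).
case: kap => -[cf ->]; [left|right]; split=> // i j l ijl;
  have := convex_on_mid cf (node_in i lr) (node_in l lr);
  by rewrite (node_mid _ _ _ ijl); lra.
Qed.

(** * The rectangle *)

Lemma sum_mxtens (R : realType) m n (F : 'I_(m * n) -> R) :
  \sum_k F k = \sum_(j < m) \sum_(i < n) F (mxtens_index (j, i)).
Proof.
rewrite pair_big/= (reindex (@mxtens_index m n))/=.
  by apply: eq_bigr => -[j i] _.
by exists (@mxtens_unindex m n) => k _; [exact: mxtens_indexK|exact: mxtens_unindexK].
Qed.

Lemma quadE (R : realType) n (X : 'M[R]_n) (v : 'cV[R]_n) :
  (v^T *m X *m v) 0 0 = \sum_i \sum_j v i 0 * X i j * v j 0.
Proof.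
rewrite mxE exchange_big/=; apply: eq_bigr => j _.
by rewrite mxE mulr_suml; apply: eq_bigr => i _; rewrite mxE.
Qed.

Lemma possemidef_opp_sympart (R : realType) n (X : 'M[R]_n) :
  (forall v : 'cV[R]_n, (v^T *m X *m v) 0 0 <= 0) -> possemidef (- sympart X).
Proof.
move=> HX; split.
  by rewrite /sympart linearN/= linearZ/= linearD/= trmxK addrC.
move=> v; rewrite mulmxN mulNmx mxE oppr_ge0 /sympart -scalemxAr -scalemxAl mxE.
rewrite mulmxDr mulmxDl mxE.
have -> : (v^T *m X^T *m v) 0 0 = (v^T *m X *m v) 0 0.
  rewrite !quadE exchange_big/=; apply: eq_bigr => i _; apply: eq_bigr => j _.
  by rewrite mxE; ring.
have := HX v; lra.
Qed.

Lemma coef_mul (R : realType) (xL xR yL yR : R) (f g : R -> R -> R) M1 M2 :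
  coefmx xL xR yL yR f M1 M2 *m coefmx xL xR yL yR g M1 M2 =
  coefmx xL xR yL yR (fun x y => f x y * g x y) M1 M2.
Proof. by rewrite mulmx_diag; congr diag_mx; apply/rowP => k; rewrite !mxE. Qed.

Lemma coef_tensl (R : realType) (xL xR yL yR : R) (f : R -> R -> R) M1 M2
    (B : 'M[R]_M1) (v : 'cV[R]_(M2 * M1)) :
  (v^T *m (coefmx xL xR yL yR f M1 M2 *m (1%:M *t B)) *m v) 0 0 =
  \sum_(j < M2) \sum_(i < M1) \sum_(k < M1)
    f (node xL xR M1 i.+1) (node yL yR M2 j.+1) * v (mxtens_index (j, i)) 0
      * B i k * v (mxtens_index (j, k)) 0.
Proof.
rewrite quadE sum_mxtens; apply: eq_bigr => j _; apply: eq_bigr => i _.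
rewrite sum_mxtens (bigD1 j)//= [X in _ + X]big1 ?addr0; last first.
  move=> j' jj'; apply: big1 => k _.
  by rewrite mul_diag_mx !mxE !mxtens_indexK/= eq_sym (negbTE jj') mul0r !mulr0 mul0r.
apply: eq_bigr => k _.
by rewrite mul_diag_mx !mxE !mxtens_indexK/= eqxx mul1r; ring.
Qed.

Lemma coef_tensr (R : realType) (xL xR yL yR : R) (f : R -> R -> R) M1 M2
    (B : 'M[R]_M2) (v : 'cV[R]_(M2 * M1)) :
  (v^T *m (coefmx xL xR yL yR f M1 M2 *m (B *t 1%:M)) *m v) 0 0 =
  \sum_(i < M1) \sum_(j < M2) \sum_(k < M2)
    f (node xL xR M1 i.+1) (node yL yR M2 j.+1) * v (mxtens_index (j, i)) 0
      * B j k * v (mxtens_index (k, i)) 0.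
Proof.
rewrite quadE sum_mxtens exchange_big/=; apply: eq_bigr => i _; apply: eq_bigr => j _.
rewrite sum_mxtens; apply: eq_bigr => k _.
rewrite (bigD1 i)//= [X in _ + X]big1 ?addr0; last first.
  move=> i' ii'.
  by rewrite mul_diag_mx !mxE !mxtens_indexK/= eq_sym (negbTE ii') !mulr0 mul0r.
by rewrite mul_diag_mx !mxE !mxtens_indexK/= eqxx mulr1; ring.
Qed.

Lemma opnorm2_diag (R : realType) n (d : 'rV[R]_n) B :
  0 <= B -> (forall k, `|d 0 k| <= B) -> 0 <= opnorm2 (diag_mx d) <= B.
Proof.
move=> B0 dB.
have ubB : ubound [set norm2 (diag_mx d *m v)
    | v in [set v : 'cV[R]_n | norm2 v <= 1]]%classic B.
  move=> _ [v /= v1 <-]; apply: (@le_trans _ _ (B * norm2 v)); last by rewrite ler_piMr.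
  rewrite -[B in leRHS](@ger0_norm _ B)// -sqrtr_sqr -sqrtrM ?sqr_ge0//.
  rewrite ler_sqrt ?mulr_ge0 ?sqr_ge0 ?sumr_ge0//; last by move=> i _; exact: sqr_ge0.
  rewrite mulr_sumr; apply: ler_sum => i _.
  rewrite mul_diag_mx mxE exprMn ler_wpM2r ?sqr_ge0//.
  by rewrite -(real_normK (num_real (d 0 i))) lerXn2r ?nnegrE.
have n0 : norm2 (0 : 'cV[R]_n) = 0.
  by rewrite /norm2 big1 ?sqrtr0// => i _; rewrite mxE expr0n.
have in0 : [set norm2 (diag_mx d *m v)
    | v in [set v : 'cV[R]_n | norm2 v <= 1]]%classic 0.
  by exists 0; rewrite /= ?mulmx0 n0.
apply/andP; split; last by apply: ge_sup => //; exists 0.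
by apply: ub_le_sup => //; exists B.
Qed.

Lemma coef_eq1 (R : realType) (xL xR yL yR : R) (f : R -> R -> R) M1 M2 :
  xL < xR -> yL < yR ->
  (forall x y, x \in `]xL, xR[ -> y \in `]yL, yR[ -> f x y = 1) ->
  coefmx xL xR yL yR f M1 M2 = 1%:M.
Proof.
move=> hx hy f1; apply/matrixP => k l; rewrite !mxE.
by rewrite f1 ?node_in.
Qed.

Lemma coef_inv (R : realType) (xL xR yL yR : R) (f : R -> R -> R) M1 M2 :
  xL < xR -> yL < yR ->
  (forall x y, x \in `]xL, xR[ -> y \in `]yL, yR[ -> f x y != 0) ->
  invmx (coefmx xL xR yL yR f M1 M2) =
  coefmx xL xR yL yR (fun x y => (f x y)^-1) M1 M2.
Proof.
move=> hx hy f0.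
have h : coefmx xL xR yL yR f M1 M2 *m
    coefmx xL xR yL yR (fun x y => (f x y)^-1) M1 M2 = 1%:M.
  by rewrite coef_mul coef_eq1// => x y xin yin; rewrite divff ?f0.
have [u _] := mulmx1_unit h.
by rewrite -[LHS]mulmx1 -h mulKmx.
Qed.

Lemma pos_bounded_gt0 (R : realType) (xL xR yL yR : R) (f : R -> R -> R) :
  pos_bounded xL xR yL yR f ->
  forall x y, x \in `]xL, xR[ -> y \in `]yL, yR[ -> 0 < f x y.
Proof.
move=> [m [B [m0 fB]]] x y xin yin.
by case/andP: (fB _ _ xin yin) => h _; exact: lt_le_trans h.
Qed.

Lemma pos_boundedV (R : realType) (xL xR yL yR : R) (f : R -> R -> R) :
  xL < xR -> yL < yR -> pos_bounded xL xR yL yR f ->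
  pos_bounded xL xR yL yR (fun x y => (f x y)^-1).
Proof.
move=> hx hy fpb; have f0 := pos_bounded_gt0 fpb.
have [m [B [m0 fB]]] := fpb.
have B0 : 0 < B.
  have /andP[_] := fB _ _ (midpoint_in hx) (midpoint_in hy).
  by apply: lt_le_trans; apply: f0; exact: midpoint_in.
exists B^-1, m^-1; split; first by rewrite invr_gt0.
move=> x y xin yin; have /andP[h1 h2] := fB _ _ xin yin.
by rewrite !lef_pV2 ?posrE ?f0// h1 h2.
Qed.

(** Every preconditioner of the theorem is a family of diagonal matrices of samples
    of a function [w], so the product with [Amx] is again of the shape of [Amx],
    with coefficients w d and w e. *)
Lemma frakD_coef (R : realType) (xL xR yL yR T alpha beta : R)
    (d e w : R -> R -> R) (X : mxfamily R) :
  xL < xR -> yL < yR -> pos_bounded xL xR yL yR w ->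
  (forall t M1 M2, X t M1 M2 = coefmx xL xR yL yR w M1 M2) ->
  (forall y M (v : 'I_M -> R), y \in `]yL, yR[ ->
     Gform alpha (fun i =>
       w (node xL xR M i.+1) y * d (node xL xR M i.+1) y * v i) v <= 0) ->
  (forall x M (v : 'I_M -> R), x \in `]xL, xR[ ->
     Gform beta (fun j =>
       w x (node yL yR M j.+1) * e x (node yL yR M j.+1) * v j) v <= 0) ->
  frakD xL xR yL yR T alpha beta d e X.
Proof.
move=> hx hy wpb XE Ga Gb; have w0 := pos_bounded_gt0 wpb.
have [m [B [m0 wB]]] := wpb.
have B0 : 0 < B.
  have /andP[_] := wB _ _ (midpoint_in hx) (midpoint_in hy).
  by apply: lt_le_trans; apply: w0; exact: midpoint_in.
have wk M1 M2 (k : 'I_(M2 * M1)) :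
    0 < w (node xL xR M1 (mxtens_unindex k).2.+1)
          (node yL yR M2 (mxtens_unindex k).1.+1).
  by apply: w0; apply: node_in.
exists (B * m^-1) => N M1 M2 _ _ _ /=; rewrite XE; split.
- split; first by rewrite tr_diag_mx.
  move=> v v0; rewrite quadE.
  have E i : \sum_j v i 0 * coefmx xL xR yL yR w M1 M2 i j * v j 0 =
     w (node xL xR M1 (mxtens_unindex i).2.+1)
       (node yL yR M2 (mxtens_unindex i).1.+1) * v i 0 ^+ 2.
    rewrite (bigD1 i)//= big1 ?addr0; last first.
      by move=> j ji; rewrite !mxE eq_sym (negbTE ji) mulr0 mul0r.
    by rewrite !mxE eqxx mulr1n; ring.
  have [k vk] : exists k, v k 0 != 0.
    apply/existsP; apply: contraNT v0; rewrite negb_exists => /forallP h.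
    apply/eqP/matrixP => i j; rewrite mxE (ord1 j); apply/eqP.
    by move: (h i); rewrite negbK.
  under eq_bigr do rewrite E.
  rewrite (bigD1 k)//=; apply: ltr_pwDl.
    by apply: mulr_gt0; [exact: wk|rewrite exprn_even_gt0].
  apply: sumr_ge0 => i _; apply: mulr_ge0; last exact: sqr_ge0.
  by apply: ltW; exact: wk.
- apply: possemidef_opp_sympart => v.
  rewrite /Amx mulmxDr -!scalemxAr !mulmxA !coef_mul.
  have scale c (Z : 'M[R]_(M2 * M1)) :
      (v^T *m (c *: Z) *m v) 0 0 = c * (v^T *m Z *m v) 0 0.
    by rewrite -scalemxAr -scalemxAl mxE.
  rewrite mulmxDr mulmxDl mxE !scale.
  have c0 (c h s : R) : 0 <= c -> 0 <= (c * h `^ s)^-1.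
    by move=> ?; rewrite invr_ge0 mulr_ge0// powR_ge0.
  rewrite coef_tensl coef_tensr.
  have hl : \sum_(j < M2) \sum_(i < M1) \sum_(k < M1)
     w (node xL xR M1 i.+1) (node yL yR M2 j.+1)
      * d (node xL xR M1 i.+1) (node yL yR M2 j.+1)
      * v (mxtens_index (j, i)) 0 * Gmx alpha M1 i k * v (mxtens_index (j, k)) 0 <= 0.
    apply: sumr_le0 => j _.
    exact: (Ga _ M1 (fun i => v (mxtens_index (j, i)) 0) (node_in _ hy)).
  have hr : \sum_(i < M1) \sum_(j < M2) \sum_(k < M2)
     w (node xL xR M1 i.+1) (node yL yR M2 j.+1)
      * e (node xL xR M1 i.+1) (node yL yR M2 j.+1)
      * v (mxtens_index (j, i)) 0 * Gmx beta M2 j k * v (mxtens_index (k, i)) 0 <= 0.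
    apply: sumr_le0 => i _.
    exact: (Gb _ M2 (fun j => v (mxtens_index (j, i)) 0) (node_in _ hx)).
  by rewrite -[leRHS]addr0; apply: lerD; apply: mulr_ge0_le0 => //; exact: c0.
- rewrite /cond2 coef_inv//; last by move=> x y xin yin; rewrite gt_eqF// w0.
  have /andP[n1 n2] : 0 <= opnorm2 (coefmx xL xR yL yR w M1 M2) <= B.
    apply: opnorm2_diag (ltW B0) _ => k; rewrite mxE gtr0_norm ?wk//.
    by case/andP: (wB _ _ (node_in (mxtens_unindex k).2 hx)
                          (node_in (mxtens_unindex k).1 hy)).
  have mi : 0 <= m^-1 by rewrite invr_ge0 ltW.
  have /andP[n3 n4] : 0 <= opnorm2
      (coefmx xL xR yL yR (fun x y => (w x y)^-1) M1 M2) <= m^-1.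
    apply: opnorm2_diag mi _ => k; rewrite mxE gtr0_norm ?invr_gt0 ?wk//.
    rewrite lef_pV2 ?posrE ?wk//.
    by case/andP: (wB _ _ (node_in (mxtens_unindex k).2 hx)
                          (node_in (mxtens_unindex k).1 hy)).
  exact: ler_pM.
Qed.

Theorem corollary3p2 (R : realType) (xL xR yL yR T alpha beta : R)
    (d e : R -> R -> R)
    (hx : xL < xR) (hy : yL < yR) (hT : 0 < T)
    (halpha : 1 < alpha < 2) (hbeta : 1 < beta < 2)
    (hd : forall x y, x \in `]xL, xR[ -> y \in `]yL, yR[ -> 0 <= d x y)
    (he : forall x y, x \in `]xL, xR[ -> y \in `]yL, yR[ -> 0 <= e x y) :
  let sa := `|cos (alpha / 2 * pi)| in
  let sb := `|cos (beta / 2 * pi)| in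
  [/\ (forall kdmin kdmax kd kemin kemax ke : R -> R,
        (forall x y, x \in `]xL, xR[ -> y \in `]yL, yR[ ->
           0 <= kdmin y /\ kdmin y <= d x y <= kdmax y) ->
        (forall x y, x \in `]xL, xR[ -> y \in `]yL, yR[ ->
           0 <= kemin x /\ kemin x <= e x y <= kemax x) ->
        (forall y, y \in `]yL, yR[ ->
           is_kappa xL xR (fun x => d x y) (kdmin y) (kdmax y) (kd y)) ->
        (forall x, x \in `]xL, xR[ ->
           is_kappa yL yR (fun y => e x y) (kemin x) (kemax x) (ke x)) ->
        (forall y, y \in `]yL, yR[ ->
           0 <= kd y - Num.sqrt 2 * (kdmax y - kdmin y) / sa) ->
        (forall x, x \in `]xL, xR[ ->
           0 <= ke x - Num.sqrt 2 * (kemax x - kemin x) / sb) ->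
        frakD xL xR yL yR T alpha beta d e (fun _ M1 M2 => 1%:M)),
      (forall kmin kmax k : R -> R,
        pos_bounded xL xR yL yR d ->
        (forall x y, x \in `]xL, xR[ -> y \in `]yL, yR[ ->
           0 <= kmin x /\ kmin x <= e x y / d x y <= kmax x) ->
        (forall x, x \in `]xL, xR[ ->
           is_kappa yL yR (fun y => e x y / d x y) (kmin x) (kmax x) (k x)) ->
        (forall x, x \in `]xL, xR[ ->
           0 <= k x - Num.sqrt 2 * (kmax x - kmin x) / sb) ->
        frakD xL xR yL yR T alpha beta d e
          (fun _ M1 M2 => invmx (coefmx xL xR yL yR d M1 M2)))
    & (forall kmin kmax k : R -> R,
        pos_bounded xL xR yL yR e ->
        (forall x y, x \in `]xL, xR[ -> y \in `]yL, yR[ ->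
           0 <= kmin y /\ kmin y <= d x y / e x y <= kmax y) ->
        (forall y, y \in `]yL, yR[ ->
           is_kappa xL xR (fun x => d x y / e x y) (kmin y) (kmax y) (k y)) ->
        (forall y, y \in `]yL, yR[ ->
           0 <= k y - Num.sqrt 2 * (kmax y - kmin y) / sa) ->
        frakD xL xR yL yR T alpha beta d e
          (fun _ M1 M2 => invmx (coefmx xL xR yL yR e M1 M2)))].
Proof.
move: halpha hbeta => /andP[a1 a2] /andP[b1 b2] sa sb.
have unit_weight (a : R) M (v p : 'I_M -> R) :
    1 < a -> a < 2 -> (forall i, p i = 1) -> Gform a (fun i => p i * v i) v <= 0.
  move=> h1 h2 p1; have -> : (fun i => p i * v i) = v.
    by apply/funext => i; rewrite p1 mul1r.
  exact: Gform_le0.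
split.
- move=> kdmin kdmax kd kemin kemax ke kd_bd ke_bd kd_k ke_k kdc kec.
  apply: (@frakD_coef _ _ _ _ _ _ _ _ _ _ (fun _ _ => 1)) => //.
  + by exists 1, 1; split=> // x y _ _; rewrite lexx.
  + by move=> t M1 M2; rewrite coef_eq1.
  + move=> y M v yin; under eq_fun do rewrite mul1r.
    apply: (Gform_is_kappa_le0 a1 a2 v hx _ (kd_k y yin) (kdc y yin)) => x xin.
    exact: kd_bd.
  + move=> x M v xin; under eq_fun do rewrite mul1r.
    apply: (Gform_is_kappa_le0 b1 b2 v hy _ (ke_k x xin) (kec x xin)) => y yin.
    exact: ke_bd.
- move=> kmin kmax k dpb k_bd k_k kc; have d0 := pos_bounded_gt0 dpb.
  apply: (@frakD_coef _ _ _ _ _ _ _ _ _ _ (fun x y => (d x y)^-1)) => //.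
  + exact: pos_boundedV.
  + by move=> t M1 M2; rewrite coef_inv// => x y xin yin; rewrite gt_eqF ?d0.
  + move=> y M v yin; apply: unit_weight => // i.
    by rewrite mulVf// gt_eqF// d0// node_in.
  + move=> x M v xin; under eq_fun do rewrite [_^-1 * _]mulrC.
    apply: (Gform_is_kappa_le0 b1 b2 v hy _ (k_k x xin) (kc x xin)) => y yin.
    exact: k_bd.
- move=> kmin kmax k epb k_bd k_k kc; have e0 := pos_bounded_gt0 epb.
  apply: (@frakD_coef _ _ _ _ _ _ _ _ _ _ (fun x y => (e x y)^-1)) => //.
  + exact: pos_boundedV.
  + by move=> t M1 M2; rewrite coef_inv// => x y xin yin; rewrite gt_eqF ?e0.
  + move=> y M v yin; under eq_fun do rewrite [_^-1 * _]mulrC.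
    apply: (Gform_is_kappa_le0 a1 a2 v hx _ (k_k y yin) (kc y yin)) => x xin.
    exact: k_bd.
  + move=> x M v xin; apply: unit_weight => // j.
    by rewrite mulVf// gt_eqF// e0// node_in.
Qed.
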